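(* Let $n$ be an integer with $5\nmid n$, and let $f_n$, $\rho$, $K_n$, $\sigma$, $\rho^{(i)}$, $\Delta_n$, $a,b,c,d,e$, $\zeta$, $A_n,B_n,C_n$ and $u_\lambda$ be as in the context. Define elements $\alpha_1,\alpha_2,\alpha_3\in\mathbb Z[\zeta]$ as follows. (1) Write $bc^2d^3e^3=p_1\cdots p_k$ with $p_1,\dots,p_k$ (not necessarily distinct) prime numbers; for each $i$ let $\pi_i$ be a prime element of $\mathbb Z[\zeta]$ dividing both $p_i$ and $A_n$ (such prime elements exist); put $\lambda_1=\prod_{i=1}^k\pi_i$ and $\alpha_1=u_{\lambda_1}\lambda_1$. (2) Write $bcd^2e^2=q_1\cdots q_r$ with $q_j$ (not necessarily distinct) primes; for each $j$ let $\pi'_j$ be a prime element of $\mathbb Z[\zeta]$ dividing both $q_j$ and $B_n$ (such exist); put $\lambda_2=\prod_j\pi'_j$ and $\alpha_2=u_{\lambda_2}\lambda_2$. (3) Write $cde=s_1\cdots s_w$ with $s_j$ (not necessarily distinct) primes; for each $j$ let $\pi''_j$ be a prime element of $\mathbb Z[\zeta]$ dividing both $s_j$ and $C_n$ (such exist); put $\lambda_3=\prod_j\pi''_j$ and $\alpha_3=u_{\lambda_3}\lambda_3$. Write $\alpha_1\alpha_2\alpha_3=\beta_0+\beta_1\zeta+\beta_2\zeta^2+\beta_3\zeta^3$ with $\beta_0,\beta_1,\beta_2,\beta_3\in\mathbb Z$, and put $$m:=\frac15\left(\left(\frac n5\right)bc^2d^3e^4-n^2(\beta_0+\beta_1+\beta_2+\beta_3)\right).$$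 Then $m\in\mathbb Z$, and $$\frac{1}{bc^2d^3e^4}\left(\beta_0\rho+\beta_1\rho^{(1)}+\beta_2\rho^{(2)}+\beta_3\rho^{(3)}-m\right)$$ is a generator of a normal integral basis of $K_n$.
   Context: For an integer $n$, let $f_n(X)=X^5+n^2X^4-(2n^3+6n^2+10n+10)X^3+(n^4+5n^3+11n^2+15n+5)X^2+(n^3+4n^2+10n+10)X+1$ (Emma Lehmer's quintic; it is irreducible over $\mathbb Q$). Let $\rho$ be a root of $f_n$ and $K_n=\mathbb Q(\rho)$, a cyclic quintic field with ring of integers $\mathcal O_{K_n}$. Let $\sigma$ be the generator of $\mathrm{Gal}(K_n/\mathbb Q)$ with $\sigma(\rho)=\frac{n+2+n\rho-\rho^2}{1+(n+2)\rho}$, and write $\rho^{(i)}=\sigma^i(\rho)$ for $i\in\mathbb Z/5\mathbb Z$. Let $\Delta_n=n^4+5n^3+15n^2+25n+25$ and write $\Delta_n=ab^2c^3d^4e^5$ with $a,b,c,d,e$ positive integers, $a,b,c,d$ square-free and pairwise coprime. $\left(\frac n5\right)$ is the Legendre symbol. Let $\zeta$ be a primitive fifth root of unity and $A_n=n+2+2\zeta^4+\zeta^2$, $B_n=n+2+2\zeta^2+\zeta$, $C_n=n+2+2\zeta^3+\zeta^4$. For $\lambda\in\mathbb Z[\zeta]$ with $\lambda\notin(1-\zeta)$, the residue of $\lambda$ modulo $(1-\zeta)$ is one of $1,-1,2,-2$, and $u_\lambda\in\mathbb Z[\zeta]^\times$ is defined to be $1$, $-1$, $\frac{1+\sqrt5}{2}$,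 $-\frac{1+\sqrt5}{2}$ respectively ($\sqrt5\in\mathbb Z[\zeta]$, computed inside $\mathbb C$). An element $\alpha\in K_n$ is a generator of a normal integral basis if $\{\alpha,\sigma(\alpha),\sigma^2(\alpha),\sigma^3(\alpha),\sigma^4(\alpha)\}$ is a $\mathbb Z$-basis of $\mathcal O_{K_n}$. *)

(* Defs.v *)
From mathcomp Require Export all_boot all_order all_algebra.
From mathcomp Require Export all_fingroup all_solvable all_field.
From mathcomp Require Import boolp.

Set Implicit Arguments.
Unset Strict Implicit.
Unset Printing Implicit Defensive.

Import GRing.Theory Num.Theory.
Local Open Scope ring_scope.

Definition lehmer_quintic (n : int) : {poly int} :=
  'X^5 + (n ^+ 2)%:P * 'X^4
  - (2 * n ^+ 3 + 6 * n ^+ 2 + 10 * n + 10)%:P * 'X^3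
  + (n ^+ 4 + 5 * n ^+ 3 + 11 * n ^+ 2 + 15 * n + 5)%:P * 'X^2
  + (n ^+ 3 + 4 * n ^+ 2 + 10 * n + 10)%:P * 'X + 1.

Definition lehmer_Delta (n : int) : int :=
  n ^+ 4 + 5 * n ^+ 3 + 15 * n ^+ 2 + 25 * n + 25.

Definition squarefree (m : nat) : Prop :=
  forall k : nat, (k ^ 2 %| m)%N -> k = 1%N.

(* The Legendre symbol (x / p), for p an odd prime. *)
Definition legendre (x : int) (p : nat) : int :=
  if (p %| x)%Z then 0
  else if [exists y : 'I_p, (Posz y ^+ 2 == x %[mod p])%Z] then 1
  else -1.

Section Zzeta.

Variable zeta : algC.

Definition Zzeta (x : algC) : Prop :=
  exists p : {poly int}, x = (map_poly intr p).[zeta].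

(* Divisibility in the ring Z[zeta]: the quotient must lie in Z[zeta]. *)
Definition Zzeta_dvd (x y : algC) : Prop :=
  exists2 q : algC, Zzeta q & y = x * q.

Definition Zzeta_unit (x : algC) : Prop :=
  Zzeta x /\ Zzeta_dvd x 1.

Definition Zzeta_prime (x : algC) : Prop :=
  [/\ Zzeta x, x <> 0, ~ Zzeta_unit x
    & forall y z : algC, Zzeta y -> Zzeta z ->
        Zzeta_dvd x (y * z) -> Zzeta_dvd x y \/ Zzeta_dvd x z].

Definition Zzeta_residue (lam r : algC) : Prop :=
  Zzeta_dvd (1 - zeta) (lam - r).

(* The value 0 is a junk value, reached only when lam is in (1 - zeta) (or
   not in Z[zeta]). [sqrtC 5] is the positive real square root. *)
Definition u_ (lam : algC) : algC :=
  if `[< Zzeta_residue lam 1 >] then 1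
  else if `[< Zzeta_residue lam (-1) >] then -1
  else if `[< Zzeta_residue lam 2 >] then (1 + sqrtC 5) / 2
  else if `[< Zzeta_residue lam (-2) >] then - ((1 + sqrtC 5) / 2)
  else 0.

Definition common_prime_divisor (p : nat) (x pi : algC) : Prop :=
  [/\ Zzeta_prime pi, Zzeta_dvd pi p%:R & Zzeta_dvd pi x].

(* N = p_0 ... p_(k-1) with p_i prime numbers, and pi_i is a prime element of
   Z[zeta] dividing both p_i and x. *)
Definition prime_element_choice (N : nat) (x : algC)
    (k : nat) (p : 'I_k -> nat) (pi : 'I_k -> algC) : Prop :=
  [/\ N = (\prod_(i < k) p i)%N, forall i, prime (p i)
    & forall i, common_prime_divisor (p i) x (pi i)].

Definition A_ (n : int) : algC := n%:~R + 2 + 2 * zeta ^+ 4 + zeta ^+ 2.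
Definition B_ (n : int) : algC := n%:~R + 2 + 2 * zeta ^+ 2 + zeta.
Definition C_ (n : int) : algC := n%:~R + 2 + 2 * zeta ^+ 3 + zeta ^+ 4.

End Zzeta.

Definition is_Z_basis (V : zmodType) (M : V -> Prop) (k : nat)
    (v : 'I_k -> V) : Prop :=
  [/\ forall i, M (v i),
      forall x, M x -> exists c : 'I_k -> int, x = \sum_(i < k) v i *~ c i
    & forall c : 'I_k -> int,
        \sum_(i < k) v i *~ c i = 0 -> forall i, c i = 0].

Definition ring_of_integers (L : fieldExtType rat) (x : L) : Prop :=
  integralOver (intr : int -> L) x.

Definition normal_integral_basis_generator (L : splittingFieldType rat)
    (sigma : gal_of {:L}) (alpha : L) : Prop :=
  is_Z_basis (@ring_of_integers L) (fun i : 'I_5 => (sigma ^+ i)%g alpha).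

(* Main.v *)
From HB Require Import structures.
From mathcomp Require Import boolp ring lra zify.
Require Import Defs.

Set Implicit Arguments.
Unset Strict Implicit.
Unset Printing Implicit Defensive.

Import Order.TTheory GRing.Theory Num.Theory.
Local Open Scope ring_scope.

(* Write tau(x) = sum_j sigma^j(x) zeta^-j for the resolvent of x in K_n.  The
   orbit of rho satisfies bilinear relations over Z[n], and these give
   tau(rho) * conj(tau(rho)) = Delta_n and tau(rho)^5 = - A B^2 C^3 D^4, where
   A = A_n, B = B_n, C = C_n and D are the conjugates of A_n.  As
   5 zeta = n^3 + 4n^2 + 10n + 10 modulo A_n, a prime p dividing Delta_n splits
   completely, and each of A, B, C, D is divisible by exactly one of the four
   primes above p.  Hence for the element alpha of the theorem the number
   theta = tau(alpha)^5 lies in Z[zeta] and is not divisible by the fifth power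
   of a nonunit.

   The congruence between the symbol (n/5) and n^2 modulo 5 makes m an integer, and
   the trace of alpha is -(n/5).  Integrality of theta makes 5 alpha integral, and so is M alpha with
   M prime to 5; hence alpha is integral.  Conversely, if x is integral and
   x = sum_j c_j sigma^j(alpha) with c_j rational, then c = sum_j c_j zeta^j
   satisfies c^5 theta = tau(x)^5, which is integral.  As Z[zeta] is Euclidean,
   hence integrally closed, and theta is free of fifth powers, c is in Z[zeta]:
   the c_j differ from c_4 by integers.  Subtracting these leaves c_4 times the
   trace of alpha, an algebraic integer, so that all the c_j are integers. *)

(** * Divisibility in a subring of a field *)

(* As for [dvdz], the arguments are transposed: [y \in sdvd S x] means that
   [x] divides [y] in [S]. *)
Definition sdvd (F : fieldType) (S : {pred F}) (x : F) : {pred F} :=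
  fun y => `[< exists2 q, q \in S & y = x * q >].

Definition sprime (F : fieldType) (S : {pred F}) (p : F) : Prop :=
  [/\ p \in S, p != 0, 1 \notin sdvd S p
    & {in S &, forall x y, x * y \in sdvd S p ->
        (x \in sdvd S p) || (y \in sdvd S p)}].

Definition has_valuation (F : fieldType) (S : {pred F}) (p x : F) (e : nat) :=
  exists2 y, (y \in S) && (y \notin sdvd S p) & x = p ^+ e * y.

Section SubringDivisibility.

Variables (F : fieldType) (S : subringClosed F).
Implicit Types x y z p : F.

Local Notation "x %| y" := (y \in sdvd S x) : ring_scope.

Lemma sdvdP x y : reflect (exists2 q, q \in S & y = x * q) (x %| y).
Proof. exact: asboolP. Qed.

Fact sdvd_zmod_closed x : zmod_closed (sdvd S x).
Proof.
split=> [|_ _ /sdvdP[q Sq ->] /sdvdP[r Sr ->]]; apply/sdvdP.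
  by exists 0; rewrite ?rpred0 ?mulr0.
by exists (q - r); rewrite ?rpredB ?mulrBr.
Qed.
HB.instance Definition _ x :=
  GRing.isZmodClosed.Build F (sdvd S x) (sdvd_zmod_closed x).

Lemma sdvdxx x : x %| x.
Proof. by apply/sdvdP; exists 1; rewrite ?rpred1 ?mulr1. Qed.

Lemma sdvd_trans y x z : x %| y -> y %| z -> x %| z.
Proof.
move=> /sdvdP[q Sq ->] /sdvdP[r Sr ->]; apply/sdvdP.
by exists (q * r); rewrite ?rpredM ?mulrA.
Qed.

Lemma sdvd_mulr x y z : z \in S -> x %| y -> x %| y * z.
Proof.
move=> Sz /sdvdP[q Sq ->]; apply/sdvdP.
by exists (q * z); rewrite ?rpredM ?mulrA.
Qed.

Lemma sdvd_mull x y z : z \in S -> x %| y -> x %| z * y.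
Proof. by rewrite mulrC; apply: sdvd_mulr. Qed.

Lemma sdvd_mul x1 x2 y1 y2 : x1 %| y1 -> x2 %| y2 -> x1 * x2 %| y1 * y2.
Proof.
move=> /sdvdP[q Sq ->] /sdvdP[r Sr ->]; apply/sdvdP.
by exists (q * r); rewrite ?rpredM // mulrACA.
Qed.

Lemma sdvd_exp2r x y m : x %| y -> x ^+ m %| y ^+ m.
Proof.
by move=> xy; elim: m => [|m IH]; rewrite ?sdvdxx // !exprS sdvd_mul.
Qed.

Lemma sdvd_exp2l x m k : x \in S -> (m <= k)%N -> x ^+ m %| x ^+ k.
Proof.
by move=> Sx /subnK <-; rewrite exprD sdvd_mull ?rpredX ?sdvdxx.
Qed.

Lemma sdvd_pmul2l z x y : z != 0 -> (z * x %| z * y) = (x %| y).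
Proof.
move=> z0; apply/sdvdP/sdvdP => -[q Sq yE]; exists q => //.
  by apply: (mulfI z0); rewrite yE mulrA.
by rewrite yE mulrA.
Qed.

Lemma sdvdNl x y : (- x %| y) = (x %| y).
Proof.
by apply/sdvdP/sdvdP => -[q Sq ->]; exists (- q); rewrite ?rpredN ?mulrNN ?mulrN ?mulNr.
Qed.

Lemma sdvd1 z : z != 0 -> (z %| 1) = (z^-1 \in S).
Proof.
move=> z0; apply/sdvdP/idP => [[q Sq zq]|Sz]; last by exists z^-1; rewrite ?divff.
by rewrite -[z^-1]mulr1 zq mulKf.
Qed.

Lemma sdvdBr x y z : x %| z - y -> (x %| z) = (x %| y).
Proof. by move=> xzy; rewrite -(subrK y z) rpredDl. Qed.

Lemma sdvd_horner (P : {poly F}) x y z : P \is a polyOver S ->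
  y \in S -> z \in S -> x %| y - z -> x %| P.[y] - P.[z].
Proof.
move=> PS Sy Sz xyz; rewrite !horner_coef -sumrB rpred_sum // => i _.
have {}PS j : P`_j \in S by move/polyOverP: PS.
rewrite -mulrBr subrXX sdvd_mull // sdvd_mulr // rpred_sum // => j _.
by rewrite rpredM ?rpredX.
Qed.

Lemma sdvd_prodB (I : finType) (G H : I -> F) x :
    (forall i, G i \in S) -> (forall i, H i \in S) ->
    (forall i, x %| G i - H i) ->
  x %| \prod_i G i - \prod_i H i.
Proof.
move=> SG SH xGH.
suff [] : \prod_i G i \in S /\ x %| \prod_i G i - \prod_i H i by [].
elim/big_rec2: _ => [|i y z _ [Sz xzy]]; first by rewrite rpred1 subrr rpred0.
split; first exact: rpredM.
rewrite (_ : _ - _ = (G i - H i) * z + H i * (z - y)); last by ring.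
by rewrite rpredD ?(sdvd_mulr Sz) ?sdvd_mull.
Qed.

Lemma sdvd_int_of_prime (p : nat) x (m : int) : prime p -> ~~ (x %| 1) ->
  x %| p%:R -> (x %| m%:~R) = (p %| m)%Z.
Proof.
move=> p_prime x1 xp; have xpm (k : int) : x %| (k * p)%:~R.
  by rewrite rmorphM sdvd_mull ?rpred_int.
apply/idP/idP => [xm|/dvdzP[k ->] //]; apply: contraR x1 => pm.
have /coprimezP[[u v] /= uv] : coprimez p m.
  by rewrite coprimezE prime_coprime // -dvdzE.
have -> : 1 = (u * p + v * m)%:~R :> F by rewrite uv.
by rewrite rmorphD !rmorphM rpredD // sdvd_mull ?rpred_int.
Qed.

Section Prime.

Variable p : F.
Hypothesis p_prime : sprime S p.

Lemma sprime_mem : p \in S. Proof. by case: p_prime. Qed.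

Lemma sprime_neq0 : p != 0. Proof. by case: p_prime. Qed.

Lemma sprime_ndvd1 : ~~ (p %| 1). Proof. by case: p_prime. Qed.

Lemma sprime_dvdM x y : x \in S -> y \in S -> (p %| x * y) = (p %| x) || (p %| y).
Proof.
move=> Sx Sy; apply/idP/orP => [pxy|[px|py]].
- by case: p_prime => _ _ _ /(_ x y Sx Sy pxy)/orP.
- exact: sdvd_mulr.
- exact: sdvd_mull.
Qed.

Lemma sprime_dvd_prod (I : finType) (G : I -> F) : (forall i, G i \in S) ->
  p %| \prod_i G i -> exists i, p %| G i.
Proof.
move=> SG; apply: contraPP => npG.
suff : \prod_i G i \in S /\ ~~ (p %| \prod_i G i) by case=> _ /negP.
elim/big_rec: _ => [|i y _ [Sy py]]; first by rewrite rpred1 sprime_ndvd1.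
rewrite rpredM // sprime_dvdM // negb_or py andbT; split=> //.
by apply/negP => pGi; apply: npG; exists i.
Qed.

Lemma sprime_dvd_exp_mul x y e : x \in S -> y \in S -> ~~ (p %| x) ->
  p ^+ e %| x * y -> p ^+ e %| y.
Proof.
move=> Sx + npx; elim: e y => [|e IH] y Sy pexy.
  by apply/sdvdP; exists y; rewrite ?mul1r.
have : p %| x * y.
  by apply: sdvd_trans pexy; rewrite exprS sdvd_mulr ?sdvdxx ?rpredX ?sprime_mem.
rewrite sprime_dvdM // (negPf npx) => /= /sdvdP[y' Sy' yE].
move: pexy; rewrite yE mulrCA exprS !sdvd_pmul2l ?sprime_neq0 //.
exact: IH.
Qed.

Lemma has_valuation_ndvd x : x \in S -> ~~ (p %| x) -> has_valuation S p x 0.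
Proof. by move=> Sx px; exists x; rewrite ?mul1r ?Sx. Qed.

Lemma has_valuation_unit x : x \in S -> x %| 1 -> has_valuation S p x 0.
Proof.
move=> Sx x1; apply: has_valuation_ndvd => //.
by apply: contra sprime_ndvd1 => px; apply: sdvd_trans x1.
Qed.

Lemma has_valuation1 : has_valuation S p 1 0.
Proof. by apply: has_valuation_unit; rewrite ?rpred1 ?sdvdxx. Qed.

Lemma has_valuationM x y e f : has_valuation S p x e -> has_valuation S p y f ->
  has_valuation S p (x * y) (e + f).
Proof.
move=> [x' /andP[Sx' px'] ->] [y' /andP[Sy' py'] ->]; exists (x' * y').
  by rewrite rpredM // sprime_dvdM // negb_or px'.
by rewrite exprD mulrACA.
Qed.

Lemma has_valuationN x e : has_valuation S p x e -> has_valuation S p (- x) e.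
Proof. by move=> [y Sy ->]; exists (- y); rewrite ?rpredN ?mulrN. Qed.

Lemma has_valuationX x e m : has_valuation S p x e ->
  has_valuation S p (x ^+ m) (m * e).
Proof.
move=> vx; elim: m => [|m IH]; first exact: has_valuation1.
by rewrite exprS mulSn; apply: has_valuationM.
Qed.

Lemma has_valuation_prod (I : finType) (G : I -> F) (e : I -> nat) :
    (forall i, has_valuation S p (G i) (e i)) ->
  has_valuation S p (\prod_i G i) (\sum_i e i).
Proof.
move=> vG; elim/big_ind2: _ => //; first exact: has_valuation1.
by move=> *; apply: has_valuationM.
Qed.

Lemma has_valuation_dvd x e f : has_valuation S p x e ->
  (p ^+ f %| x) = (f <= e)%N.
Proof.
move=> [y /andP[Sy py] ->]; apply/idP/idP => [|fe]; last first.
  by rewrite sdvd_mulr // sdvd_exp2l ?sprime_mem.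
apply: contraLR; rewrite -ltnNge => ef; apply: contra py => pfx.
rewrite -(sdvd_pmul2l p y (expf_neq0 e sprime_neq0)) -exprSr.
by apply: sdvd_trans pfx; rewrite sdvd_exp2l ?sprime_mem.
Qed.

Lemma has_valuation_inj x e f : has_valuation S p x e -> has_valuation S p x f ->
  e = f.
Proof.
move=> ve vf; apply/eqP; rewrite eqn_leq -(has_valuation_dvd _ vf).
by rewrite -(has_valuation_dvd _ ve) (has_valuation_dvd _ ve)
  (has_valuation_dvd _ vf) !leqnn.
Qed.

End Prime.

End SubringDivisibility.

Arguments sdvdP {F S x y}.
Arguments sdvd_pmul2l {F S z x y}.

(** * Euclidean subrings *)

Definition scoprime (F : fieldType) (S : {pred F}) (x y : F) : Prop :=
  exists2 u, u \in S & exists2 v, v \in S & u * x + v * y = 1.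

Definition euclidean_norm (F : fieldType) (S : {pred F}) (N : F -> nat) : Prop :=
  [/\ {in S, forall x, (N x == 0%N) = (x == 0)},
      {in S &, forall x y, N (x * y) = (N x * N y)%N}
    & {in S &, forall x y, y != 0 ->
        exists2 q, q \in S & (N (x - q * y)%R < N y)%N}].

Section Coprime.

Variables (F : fieldType) (S : subringClosed F).
Implicit Types x y z : F.

Local Notation "x %| y" := (y \in sdvd S x) : ring_scope.

Lemma scoprimeC x y : scoprime S x y -> scoprime S y x.
Proof.
by move=> [u Su [v Sv uv]]; exists v => //; exists u => //; rewrite addrC.
Qed.

Lemma scoprimeMr x y z : y \in S -> scoprime S x y -> scoprime S x z ->
  scoprime S x (y * z).
Proof.
move=> Sy [u Su [v Sv uv]] [s Ss [t St st]].
exists (u + v * y * s); first by rewrite rpredD ?rpredM.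
exists (v * t); first exact: rpredM.
transitivity (u * x + v * y * (s * x + t * z)); first by ring.
by rewrite st mulr1.
Qed.

Lemma scoprimeXr x y m : y \in S -> scoprime S x y -> scoprime S x (y ^+ m).
Proof.
move=> Sy xy; elim: m => [|m IH]; last by rewrite exprS; apply: scoprimeMr.
by exists 0; rewrite ?rpred0 //; exists 1; rewrite ?rpred1 // mul0r mul1r add0r.
Qed.

Lemma sdvd_coprimel x y z : z \in S -> scoprime S x y -> x %| y * z -> x %| z.
Proof.
move=> Sz [u Su [v Sv uv]] xyz.
rewrite -[z]mul1r -uv mulrDl rpredD //.
  by rewrite -mulrA sdvd_mull // sdvd_mulr ?sdvdxx.
by rewrite -mulrA sdvd_mull.
Qed.

End Coprime.

Section EuclideanSubring.

Variables (F : fieldType) (S : subringClosed F) (N : F -> nat).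
Hypothesis euclid : euclidean_norm S N.
Implicit Types x y z p : F.

Local Notation "x %| y" := (y \in sdvd S x) : ring_scope.

Let norm_eq0 x : x \in S -> (N x == 0%N) = (x == 0).
Proof. by case: euclid => + _ _; apply. Qed.

Let normM x y : x \in S -> y \in S -> N (x * y) = (N x * N y)%N.
Proof. by case: euclid => _ + _; apply. Qed.

Let norm_gt0 x : x \in S -> x != 0 -> (0 < N x)%N.
Proof. by move=> Sx x0; rewrite lt0n norm_eq0. Qed.

Lemma euclidean_bezout x y : x \in S -> y \in S ->
  exists d, [/\ d \in S, d %| x, d %| y &
    exists2 u, u \in S & exists2 v, v \in S & d = u * x + v * y].
Proof.
move: {2}(N y) (erefl (N y)) => k.
elim/ltn_ind: k => k IH in x y * => yk Sx Sy.
have [y0|y0] := eqVneq y 0.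
  exists x; split=> //; rewrite ?sdvdxx ?y0 ?rpred0 //.
  by exists 1; rewrite ?rpred1 //; exists 0; rewrite ?rpred0 // mul1r mul0r addr0.
have [_ _ /(_ x y Sx Sy y0)[q Sq norm_lt]] := euclid.
have Sr : x - q * y \in S by rewrite rpredB ?rpredM.
rewrite yk in norm_lt; have [d [Sd dy dr [u Su [v Sv dE]]]] := IH _ norm_lt y _ erefl Sy Sr.
exists d; split=> //.
  by rewrite (sdvdBr (y := x - q * y)) // opprB addrC subrK sdvd_mull.
exists v => //; exists (u - v * q); first by rewrite rpredB ?rpredM.
by rewrite dE; ring.
Qed.

Lemma euclidean_norm_gt1 x : x \in S -> x != 0 -> ~~ (x %| 1) -> (1 < N x)%N.
Proof.
move=> Sx x0; rewrite ltn_neqAle norm_gt0 // andbT; apply: contra => /eqP x1.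
have [_ _ /(_ 1 x (rpred1 _) Sx x0)[q Sq]] := euclid.
rewrite -x1 ltnS leqn0 norm_eq0 ?rpredB ?rpred1 ?rpredM // subr_eq0 => /eqP ->.
by rewrite sdvd_mull ?sdvdxx.
Qed.

Lemma euclidean_norm_lt x y : x \in S -> y \in S -> x != 0 -> y != 0 ->
  ~~ (y %| 1) -> (N x < N (x * y)%R)%N.
Proof.
move=> Sx Sy x0 y0 y1; rewrite normM // -[X in (X < _)%N]muln1.
by rewrite ltn_pmul2l ?norm_gt0 ?euclidean_norm_gt1.
Qed.

Lemma coprime_fraction x y : x \in S -> y \in S -> y != 0 ->
  exists x' y', [/\ x' \in S, y' \in S, y' != 0, scoprime S y' x'
    & x / y = x' / y'].
Proof.
move=> Sx Sy y0.
have [d [_ /sdvdP[x' Sx' xE] /sdvdP[y' Sy' yE] [u Su [v Sv dE]]]] :=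
  euclidean_bezout Sx Sy.
have /andP[d0 y'0] : (d != 0) && (y' != 0) by rewrite -negb_or -mulf_eq0 -yE.
exists x', y'; split=> //; last by rewrite xE yE -mulf_div divff // mul1r.
exists v => //; exists u => //; apply: (mulfI d0).
by rewrite mulr1 [RHS]dE xE yE; ring.
Qed.

(* A nonzero nonunit which is not prime divides a product [y * z] without
   dividing a factor, and then gcd (x, y) is a proper nonunit divisor of [x]. *)
Lemma prime_divisor x : x \in S -> x != 0 -> ~~ (x %| 1) ->
  exists2 p, sprime S p & p %| x.
Proof.
move: {2}(N x) (erefl (N x)) => k.
elim/ltn_ind: k => k IH in x * => xk Sx x0 x1.
have [x_prime|x_nprime] := pselect (sprime S x).
  by exists x; rewrite ?sdvdxx.
have [y [z [Sy Sz xyz xy xz]]] : exists y z,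
    [/\ y \in S, z \in S, x %| y * z, ~~ (x %| y) & ~~ (x %| z)].
  apply: contrapT => no_yz; apply: x_nprime; split=> // y z Sy Sz xyz.
  rewrite -implyNb; apply/implyP => xy; apply: contrapT => /negP xz.
  by apply: no_yz; exists y, z.
have [d [Sd /sdvdP[t St xE] dy [u Su [v Sv dE]]]] := euclidean_bezout Sx Sy.
have /andP[d0 t0] : (d != 0) && (t != 0) by rewrite -negb_or -mulf_eq0 -xE.
have d1 : ~~ (d %| 1).
  apply: contra xz => /sdvdP[q Sq dq]; rewrite -[z]mul1r dq dE.
  rewrite (_ : _ * z = x * (u * q * z) + y * z * (v * q)); last by ring.
  by rewrite rpredD // sdvd_mulr ?sdvdxx ?rpredM.
have t1 : ~~ (t %| 1).
  apply: contra xy => /sdvdP[q Sq tq]; apply: sdvd_trans dy; apply/sdvdP.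
  by exists q => //; rewrite xE -mulrA -tq mulr1.
have norm_lt : (N d < k)%N by rewrite -xk xE euclidean_norm_lt.
have [p p_prime pd] := IH _ norm_lt _ erefl Sd d0 d1; exists p => //.
by rewrite xE sdvd_mulr.
Qed.

Lemma has_valuation_exists p x : sprime S p -> x \in S -> x != 0 ->
  exists e, has_valuation S p x e.
Proof.
move=> p_prime; move: {2}(N x) (erefl (N x)) => k.
elim/ltn_ind: k => k IH in x * => xk Sx x0.
have [/sdvdP[y Sy xE]|px] := boolP (p %| x); last first.
  by exists 0%N; apply: has_valuation_ndvd.
have y0 : y != 0 by apply: contraNneq x0 => y0; rewrite xE y0 mulr0.
have p0 := sprime_neq0 p_prime; have Sp := sprime_mem p_prime.
have norm_lt : (N y < k)%N.
  by rewrite -xk xE mulrC euclidean_norm_lt // (sprime_ndvd1 p_prime).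
have [e [t St yE]] := IH _ norm_lt _ erefl Sy y0.
by exists e.+1, t; rewrite // xE yE exprS mulrA.
Qed.

Lemma has_valuation_divl p x y m r : sprime S p -> y \in S ->
  has_valuation S p x m -> has_valuation S p (x * y) r ->
  has_valuation S p y (r - m).
Proof.
move=> p_prime Sy vx vxy; have y0 : y != 0.
  apply: contraNneq (expf_neq0 r (sprime_neq0 p_prime)) => y0.
  case: vxy => t /andP[_ pt]; rewrite y0 mulr0 => /esym/eqP.
  by rewrite mulf_eq0 => /orP[//|/eqP t0]; rewrite t0 rpred0 in pt.
have [e vy] := has_valuation_exists p_prime Sy y0.
by rewrite -(has_valuation_inj p_prime (has_valuationM p_prime vx vy) vxy) addKn.
Qed.

Lemma sdvd_local x y : x \in S -> y \in S -> x != 0 ->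
    (forall p e, sprime S p -> has_valuation S p x e -> p ^+ e %| y) ->
  x %| y.
Proof.
move: {2}(N x) (erefl (N x)) => k.
elim/ltn_ind: k => k IH in x y * => xk Sx Sy x0 x_local.
have [x1|x1] := boolP (x %| 1); first by rewrite -[y]mul1r sdvd_mulr.
have [p p_prime px] := prime_divisor Sx x0 x1.
have [e vx] := has_valuation_exists p_prime Sx x0.
have Sp := sprime_mem p_prime; have p0 := sprime_neq0 p_prime.
have /sdvdP[y' Sy' yE] : p %| y.
  apply: sdvd_trans (x_local p e p_prime vx); apply: (sdvd_exp2l (m := 1)) => //.
  by rewrite -(has_valuation_dvd p_prime _ vx) expr1.
have /sdvdP[x' Sx' xE] := px.
have x'0 : x' != 0 by apply: contraNneq x0 => x'0; rewrite xE x'0 mulr0.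
have norm_lt : (N x' < k)%N.
  by rewrite -xk xE mulrC euclidean_norm_lt // (sprime_ndvd1 p_prime).
rewrite xE yE sdvd_pmul2l //; apply: (IH _ norm_lt) => // q f q_prime vx'.
have [g vp] := has_valuation_exists q_prime Sp p0.
have := x_local q (g + f)%N q_prime; rewrite xE yE => /(_ (has_valuationM q_prime vp vx')).
have q0 := sprime_neq0 q_prime.
case: vp => t /andP[St qt] ->; rewrite exprD -mulrA sdvd_pmul2l ?expf_neq0 //.
exact: sprime_dvd_exp_mul.
Qed.

Lemma euclidean_integrally_closed (P : {poly F}) d x :
    d \in S -> d != 0 -> d * x \in S ->
    P \is monic -> P \is a polyOver S -> root P x ->
  x \in S.
Proof.
move=> Sd d0 Sdx P_monic PS Px.
have [y [z [Sy Sz z0 zy xE]]] := coprime_fraction Sdx Sd d0.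
rewrite mulrAC divff // mul1r in xE; have zx : z * x = y by rewrite xE mulrC divfK.
set m := (size P).-1; have size_P : size P = m.+1.
  by rewrite prednK // size_poly_gt0 monic_neq0.
have z_dvd : z %| y ^+ m.
  have -> : y ^+ m = - \sum_(i < m) P`_i * (y ^+ i * z ^+ (m - i)).
    apply/eqP; rewrite -addr_eq0; apply/eqP.
    transitivity (z ^+ m * P.[x]); last by rewrite (rootP Px) mulr0.
    rewrite horner_coef size_P big_ord_recr /= -/(lead_coef P) (monicP P_monic).
    rewrite mul1r mulrDr -exprMn zx addrC mulr_sumr.
    congr (_ + _); apply: eq_bigr => i _.
    have -> : z ^+ m = z ^+ (m - i) * z ^+ i by rewrite -exprD subnK // ltnW.
    by rewrite -zx exprMn; ring.
  rewrite rpredN rpred_sum // => i _; rewrite sdvd_mull //.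
    exact: (polyOverP PS).
  rewrite sdvd_mull ?rpredX // -[X in _ \in sdvd _ X]expr1 sdvd_exp2l //.
  by rewrite subn_gt0.
rewrite xE rpredM // -sdvd1 //.
by apply: (sdvd_coprimel (rpred1 _) (scoprimeXr m Sy zy)); rewrite mulr1.
Qed.

Lemma euclidean_power_free m t d x :
    t \in S -> (forall z, z \in S -> z ^+ m %| t -> z %| 1) ->
    d \in S -> d != 0 -> d * x \in S -> x ^+ m * t \in S ->
  x \in S.
Proof.
move=> St t_free Sd d0 Sdx Sxt.
have [y [z [Sy Sz z0 zy xE]]] := coprime_fraction Sdx Sd d0.
rewrite mulrAC divff // mul1r in xE.
have z1 : z %| 1.
  apply: t_free => //; apply: (@sdvd_coprimel _ _ _ (y ^+ m)) => //.
    by apply: scoprimeXr => //; apply: scoprimeC; apply: scoprimeXr => //; apply: scoprimeC.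
  apply/sdvdP; exists (x ^+ m * t) => //.
  by rewrite mulrA -exprMn xE [z * _]mulrC divfK.
by rewrite xE rpredM // -sdvd1.
Qed.

End EuclideanSubring.

(** * The ring Z[zeta] *)

Definition Zint (z : algC) : {pred algC} := fun x => `[< Zzeta z x >].

Definition cubic_at (R : nzRingType) (z u0 u1 u2 u3 : R) : R :=
  u0 + u1 * z + u2 * z ^+ 2 + u3 * z ^+ 3.

Lemma prim5_exp4 (F : fieldType) (z : F) : 5.-primitive_root z ->
  z ^+ 4 = - 1 - z - z ^+ 2 - z ^+ 3.
Proof.
move=> z_prim; have z5 := prim_expr_order z_prim.
have z1 : z - 1 != 0.
  by rewrite subr_eq0 -[z]expr1 -(prim_order_dvd z_prim).
apply/eqP; rewrite -subr_eq0; apply/eqP; apply: (mulfI z1).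
by ring: z5.
Qed.

Lemma prim5_exp (F : fieldType) (z : F) k : 5.-primitive_root z ->
  (0 < k < 5)%N -> 5.-primitive_root (z ^+ k).
Proof.
move=> z_prim k5; rewrite prim_root_exp_coprime //.
by move: k k5 => [|[|[|[|[|]]]]].
Qed.

Lemma prim5_conj (z : algC) : 5.-primitive_root z -> z^* = z ^+ 4.
Proof.
move=> z_prim; have z5 := prim_expr_order z_prim.
have z1 : `|z| = 1 by apply/eqP; rewrite -(pexpr_eq1 (n := 5)) // -normrX z5 normr1.
have z0 : z != 0 by rewrite -normr_eq0 z1 oner_eq0.
by apply: (mulfI z0); rewrite -normCK z1 expr1n -exprS z5.
Qed.

Lemma cubic_at_aut (R S : nzRingType) (f : {rmorphism R -> S}) z u0 u1 u2 u3 :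
  f (cubic_at z u0 u1 u2 u3) = cubic_at (f z) (f u0) (f u1) (f u2) (f u3).
Proof. by rewrite /cubic_at !(rmorphD, rmorphXn, rmorphM). Qed.

Lemma horner_map_intr (R S : nzRingType) (f : {rmorphism R -> S}) (P : {poly int}) z :
  f (map_poly intr P).[z] = (map_poly intr P).[f z].
Proof.
rewrite -horner_map -map_poly_comp; congr _.[_].
by apply: eq_map_poly => a /=; rewrite rmorph_int.
Qed.

Lemma ZintP {z x : algC} : reflect (Zzeta z x) (x \in Zint z).
Proof. exact: asboolP. Qed.

Section ZintTheory.

Variable z : algC.
Implicit Types x y : algC.

Fact Zint_subring_closed : subring_closed (Zint z).
Proof.
split=> [|_ _ /ZintP[p ->] /ZintP[q ->]|_ _ /ZintP[p ->] /ZintP[q ->]]; apply/ZintP.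
- by exists 1; rewrite rmorph1 hornerC.
- by exists (p - q); rewrite rmorphB hornerD hornerN.
- by exists (p * q); rewrite rmorphM hornerM.
Qed.
HB.instance Definition _ :=
  GRing.isSubringClosed.Build algC (Zint z) Zint_subring_closed.

Lemma Zint_gen : z \in Zint z.
Proof. by apply/ZintP; exists 'X; rewrite map_polyX hornerX. Qed.

Lemma Zint_sub w : w \in Zint z -> {subset Zint w <= Zint z}.
Proof.
move=> Zw _ /ZintP[P ->]; apply: rpred_horner => //.
by apply/polyOverP => i; rewrite coef_map rpred_int.
Qed.

Lemma Zint_aut (nu : {rmorphism algC -> algC}) x : nu z \in Zint z ->
  x \in Zint z -> nu x \in Zint z.
Proof.
move=> Znuz /ZintP[P ->]; rewrite horner_map_intr.
by apply: Zint_sub Znuz _ _; apply/ZintP; exists P.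
Qed.

Lemma sdvd_aut (nu : {rmorphism algC -> algC}) x y : nu z \in Zint z ->
  y \in sdvd (Zint z) x -> nu y \in sdvd (Zint z) (nu x).
Proof.
move=> Znuz /sdvdP[q Zq ->]; apply/sdvdP.
by exists (nu q); [apply: Zint_aut | rewrite rmorphM].
Qed.

Lemma Zzeta_dvdP x y : reflect (Zzeta_dvd z x y) (y \in sdvd (Zint z) x).
Proof. by apply: (iffP sdvdP) => -[q /ZintP Zq ->]; exists q. Qed.

Lemma Zzeta_primeP p : Zzeta_prime z p <-> sprime (Zint z) p.
Proof.
split=> [[Zp p0 p1 pM]|[Zp p0 p1 pM]]; split.
- exact/ZintP.
- exact/eqP.
- by apply/negP => /Zzeta_dvdP p_dvd1; apply: p1.
- move=> x y /ZintP Zx /ZintP Zy /Zzeta_dvdP/(pM _ _ Zx Zy) pxy.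
  by apply/orP; case: pxy => /Zzeta_dvdP; [left|right].
- exact/ZintP.
- exact/eqP.
- by case=> _ /Zzeta_dvdP; apply/negP.
- move=> x y /ZintP Zx /ZintP Zy /Zzeta_dvdP/(pM _ _ Zx Zy)/orP.
  by case=> /Zzeta_dvdP; [left|right].
Qed.

Lemma common_prime_divisorP p x pi : common_prime_divisor z p x pi <->
  [/\ sprime (Zint z) pi, p%:R \in sdvd (Zint z) pi & x \in sdvd (Zint z) pi].
Proof.
split=> [[pi_prime /Zzeta_dvdP pi_p /Zzeta_dvdP pi_x]|
         [pi_prime /Zzeta_dvdP pi_p /Zzeta_dvdP pi_x]].
  by split=> //; apply/Zzeta_primeP.
by split=> //; apply/Zzeta_primeP.
Qed.

Hypothesis z_Aint : z \in Aint.

Lemma Zint_Aint : {subset Zint z <= Aint}.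
Proof.
move=> _ /ZintP[P ->]; apply: rpred_horner => //.
by apply/polyOverP => i; rewrite coef_map Aint_int.
Qed.

Lemma Zint_dvd_int (d m : int) : (m%:~R \in sdvd (Zint z) d%:~R) = (d %| m)%Z.
Proof.
apply/sdvdP/dvdzP => [[q Zq mE]|[q ->]]; last first.
  by exists q%:~R; rewrite ?rpred_int // rmorphM mulrC.
have [d0|d0] := eqVneq d 0.
  by exists 0; apply: (@intr_inj algC); rewrite mE d0 !mul0r.
have dC : d%:~R != 0 :> algC by rewrite intr_eq0.
have /intrP[k qk] : q \in Num.int.
  apply: Cint_rat_Aint (Zint_Aint Zq).
  by rewrite -(mulKf dC q) -mE rpredM ?rpredV ?rpred_int.
by exists k; apply: (@intr_inj algC); rewrite mE qk rmorphM mulrC.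
Qed.

Lemma Zint_dvd_nat (d m : nat) : (m%:R \in sdvd (Zint z) d%:R) = (d %| m)%N.
Proof. exact: (Zint_dvd_int d m). Qed.

End ZintTheory.

Arguments Zzeta_dvdP {z x y}.
Arguments Zint_aut {z nu x}.

Lemma prim_root_relation l (z : algC) (q : nat -> rat) : prime l.+1 ->
    l.+1.-primitive_root z -> \sum_(j < l.+1) ratr (q j) * z ^+ j = 0 ->
  forall j, (j <= l)%N -> q j = q l.
Proof.
move=> l_prime z_prim qz0.
have z_sum : \sum_(j < l.+1) z ^+ j = 0.
  have z1 : z - 1 != 0.
    by rewrite subr_eq0 -[z]expr1 -(prim_order_dvd z_prim) dvdn1 gtn_eqF ?prime_gt1.
  by apply: (mulfI z1); rewrite -subrX1 (prim_expr_order z_prim) subrr mulr0.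
pose P := \poly_(j < l) (q j - q l); have P_size : (size P <= l)%N := size_poly _ _.
have [m [mE m_monic] m_dvd] := minCpolyP z.
have m_size : size m = l.+1.
  rewrite -(size_map_poly (ratr : {rmorphism rat -> algC})) -mE.
  by rewrite (minCpoly_cyclotomic z_prim) size_cyclotomic totient_prime.
have P_root : root (map_poly ratr P) z.
  rewrite rootE (horner_coef_wide (n := l)) ?size_map_poly //.
  transitivity (\sum_(j < l.+1) ratr (q j - q l) * z ^+ j == 0).
    rewrite big_ord_recr /= subrr rmorph0 mul0r addr0; congr (_ == _).
    by apply: eq_bigr => j _; rewrite coef_map coef_poly ltn_ord.
  under eq_bigr => j _ do rewrite rmorphB mulrBl.
  by rewrite sumrB qz0 -mulr_sumr z_sum mulr0 subrr eqxx.
have P0 : P = 0.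
  apply/eqP; apply: contraTT P_size => P0.
  by rewrite -ltnNge -m_size dvdp_leq // -m_dvd.
move=> j; rewrite leq_eqVlt => /predU1P[-> //|jl]; apply/eqP; rewrite -subr_eq0.
by have := coef_poly l (fun i => q i - q l) j; rewrite jl -/P P0 coef0 => <-.
Qed.

Section PrimitiveFifthRoot.

Variable zeta : algC.
Hypothesis zeta_prim : 5.-primitive_root zeta.

Let z5 : zeta ^+ 5 = 1 := prim_expr_order zeta_prim.
Let z4 := prim5_exp4 zeta_prim.

Local Notation "x %| y" := (y \in sdvd (Zint zeta) x) : ring_scope.

Lemma Zint_prim5 w : 5.-primitive_root w -> Zint w =i Zint zeta.
Proof.
move=> w_prim x; have w5 := prim_expr_order w_prim.
have [i wE] := prim_rootP zeta_prim w5; have [j zetaE] := prim_rootP w_prim z5.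
apply/idP/idP; apply: Zint_sub.
  by rewrite wE rpredX ?Zint_gen.
by rewrite zetaE rpredX ?Zint_gen.
Qed.

Lemma unity5_mem_Zint w : w ^+ 5 = 1 -> w \in Zint zeta.
Proof. by move=> /(prim_rootP zeta_prim)[i ->]; rewrite rpredX ?Zint_gen. Qed.

Lemma prim5_aut w : 5.-primitive_root w ->
  exists nu : {rmorphism algC -> algC}, nu zeta = w.
Proof.
move=> w_prim; have [k wE] := prim_rootP zeta_prim (prim_expr_order w_prim).
have [|nu nuE] := @Qn_aut_exists k 5; last by exists nu; rewrite nuE.
by rewrite -(prim_root_exp_coprime k zeta_prim) -wE.
Qed.

Lemma Zint_cubicP x :
  reflect (exists u0 u1 u2 u3 : int, x = cubic_at zeta u0%:~R u1%:~R u2%:~R u3%:~R)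
    (x \in Zint zeta).
Proof.
apply: (iffP idP) => [/ZintP[P ->]|[u0 [u1 [u2 [u3 ->]]]]]; last first.
  by rewrite !(rpredD, rpredM, rpredX) ?rpred_int ?Zint_gen.
elim/poly_ind: P => [|P c [u0 [u1 [u2 [u3 IH]]]]].
  by exists 0, 0, 0, 0; rewrite rmorph0 horner0 /cubic_at; ring.
exists (c - u3), (u0 - u3), (u1 - u3), (u2 - u3).
rewrite rmorphD rmorphM /= map_polyX map_polyC hornerMXaddC IH /cubic_at /=.
by rewrite !rmorphB /=; ring: z4.
Qed.

Lemma Zint_rat_coords (q : nat -> rat) :
    \sum_(j < 5) ratr (q j) * zeta ^+ j \in Zint zeta ->
  forall j, (j < 5)%N -> q j - q 4%N \in Num.int.
Proof.
move=> /Zint_cubicP[u0 [u1 [u2 [u3 E]]]] j j5.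
pose u j : int := [:: u0; u1; u2; u3]`_j.
have relation : \sum_(i < 5) ratr (q i - (u i)%:~R) * zeta ^+ i = 0.
  under eq_bigr => i _ do rewrite rmorphB /= ratr_int mulrBl.
  rewrite sumrB E !big_ord_recl big_ord0 /u /cubic_at /bump /=; ring.
have := prim_root_relation (q := fun i => q i - (u i)%:~R) (l := 4) isT zeta_prim relation.
move=> /(_ j); rewrite subr0 => /(_ j5) <-.
by rewrite opprB addrC subrK rpred_int.
Qed.

(* [w' / w] is a nontrivial fifth root of unity, so that [1 - w' / w] divides 5. *)
Lemma prim5_sub_dvd5 w w' : w ^+ 5 = 1 -> w' ^+ 5 = 1 -> w != w' ->
  w - w' %| 5.
Proof.
move=> w5 w'5 ww'; have Zw := unity5_mem_Zint w5; have Zw' := unity5_mem_Zint w'5.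
apply/sdvdP; exists (4 * w ^+ 4 + 3 * w ^+ 3 * w' + 2 * w ^+ 2 * w' ^+ 2 + w * w' ^+ 3).
  by rewrite !(rpredD, rpredM, rpredX, rpred1).
have sum0 : w ^+ 4 + w ^+ 3 * w' + w ^+ 2 * w' ^+ 2 + w * w' ^+ 3 + w' ^+ 4 = 0.
  apply: (mulfI (_ : w - w' != 0)); first by rewrite subr_eq0.
  by ring: w5 w'5.
transitivity (5 * w ^+ 5 - w * (w ^+ 4 + w ^+ 3 * w' + w ^+ 2 * w' ^+ 2 + w * w' ^+ 3 + w' ^+ 4)).
  by rewrite w5 sum0; ring.
ring.
Qed.

End PrimitiveFifthRoot.

(** * The Euclidean algorithm in Z[zeta] *)

Lemma floor_arc_representative (u : rat) (k : int) :
    ~~ (5 %| Num.floor (5 * u) - k)%Z ->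
  exists s : int, (k%:~R - 4) / 5 <= u - s%:~R < k%:~R / 5.
Proof.
set m := Num.floor _ => m_k; set q := ((m - k) %/ 5)%Z.
have /andP[le_m lt_m] : m%:~R <= 5 * u < (m + 1)%:~R := floor_itv _.
have [j0 j5] : (1 <= (m - k) %% 5)%Z /\ ((m - k) %% 5 <= 4)%Z.
  have := modz_ge0 (m - k) (isT : 5%:Z != 0).
  have := ltz_pmod (m - k) (isT : 0 < 5%:Z).
  have : ((m - k) %% 5)%Z != 0 by apply: contraNneq m_k => /dvdz_mod0P.
  lia.
have mE : m%:~R = k%:~R + q%:~R * 5 + ((m - k) %% 5)%Z%:~R :> rat.
  have := congr1 (fun t : int => t%:~R : rat) (divz_eq (m - k) 5).
  by rewrite -/q rmorphB rmorphD rmorphM /=; lra.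
move: (_ %% _)%Z j0 j5 mE => j j0 j5 mE.
have {}j0 : 1 <= j%:~R :> rat by rewrite (ler_int _ 1).
have {}j5 : j%:~R <= 4 :> rat by rewrite (ler_int _ _ 4).
exists (q + 1); move: lt_m le_m; rewrite !rmorphD /= mulr1z mE.
by move: (k%:~R) (q%:~R) (j%:~R) j0 j5 => *; lra.
Qed.

(* The residues modulo 5 outnumber the four coordinates, so one of them is
   missed: cut the circle R/Z at the corresponding arc of length 1/5. *)
Lemma common_rounding (u : 'I_4 -> rat) : exists (c : rat) (s : 'I_4 -> int),
  -2/5 <= c <= 2/5 /\ forall i, -2/5 <= u i - (s i)%:~R - c < 2/5.
Proof.
pose t i : 'I_5 := inord `|(Num.floor (5 * u i)%R %% 5)%Z|.
have [k k_t] : exists k, k \notin codom t.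
  apply/existsP; apply: contraT; rewrite negb_exists => /forallP t_onto.
  have : (#|'I_5| <= #|codom t|)%N.
    by apply/subset_leq_card/subsetP => k _; have := t_onto k; rewrite negbK.
  by move=> /leq_trans/(_ (leq_image_card t 'I_4)); rewrite !card_ord.
have /choice[s s_arc] i : exists s : int,
    (k%:R - 4) / 5 <= u i - s%:~R < k%:R / 5.
  apply: (floor_arc_representative (k := k)); apply: contra k_t => k_u.
  suff -> : k = t i by apply: codom_f.
  rewrite -eqz_mod_dvd in k_u; rewrite /t (eqP k_u) modz_small ?inord_val //.
  by rewrite lez_nat ltz_nat ltn_ord.
have k5 : 0 <= (k%:R : rat) <= 4 by rewrite ler0n (ler_nat _ k 4) -ltnS ltn_ord.
exists ((k%:R - 2) / 5), s; split=> [|i]; first lra.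
by have := s_arc i; lra.
Qed.

Lemma spread_lt4 (w0 w1 w2 w3 w4 : rat) :
    -2/5 <= w0 < 2/5 -> -2/5 <= w1 < 2/5 -> -2/5 <= w2 < 2/5 ->
    -2/5 <= w3 < 2/5 -> -2/5 <= w4 <= 2/5 ->
  5 * (w0 ^+ 2 + w1 ^+ 2 + w2 ^+ 2 + w3 ^+ 2 + w4 ^+ 2)
    - (w0 + w1 + w2 + w3 + w4) ^+ 2 < 4.
Proof.
move=> w0_bd w1_bd w2_bd w3_bd w4_bd; rewrite ltNge; apply/negP => spread4.
have sqr_le (w : rat) : -2/5 <= w <= 2/5 -> w ^+ 2 <= 4/25 by move=> ?; nra.
have := (sqr_le w0, sqr_le w1, sqr_le w2, sqr_le w3, sqr_le w4).
move=> [[[[q0 q1] q2] q3] q4].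
have sum2 := sqr_ge0 (w0 + w1 + w2 + w3 + w4).
have extremal (w : rat) : -2/5 <= w < 2/5 -> 4/25 <= w ^+ 2 -> w = -2/5.
  by move=> ? ?; apply/eqP; rewrite eq_le; apply/andP; split; [nra | lra].
have w0E : w0 = -2/5 by apply: extremal; lra.
have w1E : w1 = -2/5 by apply: extremal; lra.
have w2E : w2 = -2/5 by apply: extremal; lra.
have w3E : w3 = -2/5 by apply: extremal; lra.
by subst; nra.
Qed.

(* [|x|^2 = sqnorm_rat + sqnorm_irr * (zeta + zeta^-1)] for the element [x] with
   rational coordinates [u0, u1, u2, u3]. *)
Definition sqnorm_rat (R : nzRingType) (u0 u1 u2 u3 : R) : R :=
  u0 ^+ 2 + u1 ^+ 2 + u2 ^+ 2 + u3 ^+ 2 - (u0 * u2 + u1 * u3 + u0 * u3).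

Definition sqnorm_irr (R : nzRingType) (u0 u1 u2 u3 : R) : R :=
  u0 * u1 + u1 * u2 + u2 * u3 - (u0 * u2 + u1 * u3 + u0 * u3).

Section CyclotomicNorm.

Variable zeta : algC.
Hypothesis zeta_prim : 5.-primitive_root zeta.
Variable nu : {rmorphism algC -> algC}.
Hypothesis nu_zeta : nu zeta = zeta ^+ 2.

Let z4 := prim5_exp4 zeta_prim.

Local Notation Z := (Zint zeta).

Definition cyclonorm (x : algC) : algC := `|x| ^+ 2 * `|nu x| ^+ 2.

Lemma cyclonormM x y : cyclonorm (x * y) = cyclonorm x * cyclonorm y.
Proof. by rewrite /cyclonorm rmorphM !normrM; ring. Qed.

Lemma cyclonorm_ge0 x : 0 <= cyclonorm x.
Proof. by rewrite mulr_ge0 ?exprn_ge0. Qed.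

Lemma cyclonorm_eq0 x : (cyclonorm x == 0) = (x == 0).
Proof. by rewrite mulf_eq0 !sqrf_eq0 !normr_eq0 fmorph_eq0 orbb. Qed.

Lemma sqnorm_cubic_at (w : algC) (u0 u1 u2 u3 : rat) : 5.-primitive_root w ->
  `|cubic_at w (ratr u0) (ratr u1) (ratr u2) (ratr u3)| ^+ 2 =
  ratr (sqnorm_rat u0 u1 u2 u3) + ratr (sqnorm_irr u0 u1 u2 u3) * (w + w ^+ 4).
Proof.
move=> w_prim; have w4 := prim5_exp4 w_prim.
rewrite normCK cubic_at_aut /= (prim5_conj w_prim) !fmorph_rat.
rewrite /cubic_at /sqnorm_rat /sqnorm_irr.
rewrite !(rmorphD, rmorphB, rmorphN, rmorphM, rmorphXn) /=.
by ring: w4.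
Qed.

Lemma cyclonorm_cubic_at (u0 u1 u2 u3 : rat) :
  let s := sqnorm_rat u0 u1 u2 u3 in let t := sqnorm_irr u0 u1 u2 u3 in
  cyclonorm (cubic_at zeta (ratr u0) (ratr u1) (ratr u2) (ratr u3)) =
  ratr (s ^+ 2 - s * t - t ^+ 2).
Proof.
move=> s t; have z2_prim := prim5_exp (k := 2) zeta_prim isT.
rewrite /cyclonorm cubic_at_aut !fmorph_rat nu_zeta !sqnorm_cubic_at // -/s -/t.
move: s t => s t; rewrite !(rmorphB, rmorphM, rmorphXn) /=.
by ring: z4.
Qed.

Lemma cyclonorm_nat x : x \in Z -> cyclonorm x \in Num.nat.
Proof.
move=> /(Zint_cubicP zeta_prim)[u0 [u1 [u2 [u3 ->]]]].
rewrite natrEint cyclonorm_ge0 andbT -!(ratr_int algC) cyclonorm_cubic_at Cint_rat.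
rewrite /sqnorm_rat /sqnorm_irr.
by rewrite !(rpredB, rpredD, rpredM, rpredX) ?rpred_int.
Qed.

Lemma cyclonorm_codivisor x : x \in Z -> exists2 x', x' \in Z & x * x' = cyclonorm x.
Proof.
move=> Zx; have Zconj y : y \in Z -> y^* \in Z.
  by apply: Zint_aut; rewrite /= (prim5_conj zeta_prim) rpredX ?Zint_gen.
have Znu : nu x \in Z by apply: Zint_aut => //; rewrite nu_zeta rpredX ?Zint_gen.
exists (x^* * (nu x * (nu x)^*)); first by rewrite !rpredM ?Zconj.
by rewrite /cyclonorm !normCK mulrA.
Qed.

(* By the AM-GM inequality it is enough to make the average of [|x|^2] and
   [|nu x|^2] smaller than 1; that average is an eighth of the left-hand side. *)
Lemma cyclonorm_lt1 (u0 u1 u2 u3 : rat) :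
    5 * (u0 ^+ 2 + u1 ^+ 2 + u2 ^+ 2 + u3 ^+ 2) - (u0 + u1 + u2 + u3) ^+ 2 < 4 ->
  cyclonorm (cubic_at zeta (ratr u0) (ratr u1) (ratr u2) (ratr u3)) < 1.
Proof.
move=> spread; rewrite cyclonorm_cubic_at -(rmorph1 (ratr : {rmorphism rat -> algC})).
rewrite ltr_rat; set s := sqnorm_rat _ _ _ _; set t := sqnorm_irr _ _ _ _.
have sum_lt2 : 2 * s - t < 2 by move: spread; rewrite /s /t /sqnorm_rat /sqnorm_irr; lra.
have sum_ge0 : 0 <= 2 * s - t.
  have := (sqr_ge0 (u0 - u1), sqr_ge0 (u0 - u2), sqr_ge0 (u0 - u3), sqr_ge0 (u1 - u2)).
  have := (sqr_ge0 (u1 - u3), sqr_ge0 (u2 - u3)).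
  have := (sqr_ge0 u0, sqr_ge0 u1, sqr_ge0 u2, sqr_ge0 u3).
  by rewrite /s /t /sqnorm_rat /sqnorm_irr => -[[[? ?] ?] ?] [? ?] [[[? ?] ?] ?]; lra.
have -> : s ^+ 2 - s * t - t ^+ 2 = ((2 * s - t) ^+ 2 - 5 * t ^+ 2) / 4 by field.
by have := sqr_ge0 t; nra.
Qed.

Lemma cyclonorm_rounding x y : x \in Z -> y \in Z -> y != 0 ->
  exists2 q, q \in Z & cyclonorm (x - q * y) < cyclonorm y.
Proof.
move=> Zx Zy y0; have [y' Zy' yy'] := cyclonorm_codivisor Zy.
have /natrP[m my] := cyclonorm_nat Zy; rewrite my in yy'.
have m0 : m%:R != 0 :> algC by rewrite -my cyclonorm_eq0.
have /(Zint_cubicP zeta_prim)[v0 [v1 [v2 [v3 xy']]]] : x * y' \in Z by rewrite rpredM.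
pose v (i : 'I_4) : rat := [:: v0%:~R; v1%:~R; v2%:~R; v3%:~R]`_i / m%:R.
have [c [s [c_bd vs]]] := common_rounding v.
pose S (j : nat) : int := s (inord j).
pose r (j : nat) : rat := [:: v0%:~R; v1%:~R; v2%:~R; v3%:~R]`_j / m%:R - (S j)%:~R.
have r_bd j : (j < 4)%N -> -2/5 <= r j - c < 2/5.
  by move=> j4; have := vs (inord j); rewrite /v inordK.
exists (cubic_at zeta (S 0%N)%:~R (S 1%N)%:~R (S 2%N)%:~R (S 3%N)%:~R).
  by apply/Zint_cubicP => //; exists (S 0%N), (S 1%N), (S 2%N), (S 3%N).
have -> : x - cubic_at zeta (S 0%N)%:~R (S 1%N)%:~R (S 2%N)%:~R (S 3%N)%:~R * y =
    cubic_at zeta (ratr (r 0%N)) (ratr (r 1%N)) (ratr (r 2%N)) (ratr (r 3%N)) * y.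
  have xE : x = x * y' / m%:R * y.
    by apply: (mulIf m0); rewrite -[in LHS]yy' mulrAC divfK //; ring.
  rewrite [X in X - _]xE -mulrBl xy' /r /cubic_at; congr (_ * _).
  by rewrite !rmorphB !fmorph_div /= !ratr_int !ratr_nat; field.
rewrite cyclonormM gtr_pMl; last by rewrite lt_def cyclonorm_eq0 y0 cyclonorm_ge0.
apply: cyclonorm_lt1.
have c_bd' : -2/5 <= - c <= 2/5 by lra.
have := spread_lt4 (r_bd 0%N isT) (r_bd 1%N isT) (r_bd 2%N isT) (r_bd 3%N isT) c_bd'.
by move: (r 0%N) (r 1%N) (r 2%N) (r 3%N) => r0 r1 r2 r3; lra.
Qed.

End CyclotomicNorm.

Lemma Zint_euclidean zeta : 5.-primitive_root zeta ->
  exists N, euclidean_norm (Zint zeta) N.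
Proof.
move=> zeta_prim.
have [nu nuE] := prim5_aut zeta_prim (prim5_exp (k := 2) zeta_prim isT).
have N_nat := cyclonorm_nat zeta_prim nuE.
exists (fun x => Num.truncn (cyclonorm nu x)); split=> [x Zx|x y Zx Zy|x y Zx Zy y0].
- by rewrite -(eqr_nat algC) truncnK ?N_nat // cyclonorm_eq0.
- by rewrite cyclonormM truncnM ?N_nat.
have [q Zq lt] := cyclonorm_rounding zeta_prim nuE Zx Zy y0; exists q => //.
by rewrite -(ltr_nat algC) !truncnK ?N_nat ?rpredB ?rpredM.
Qed.

(** * Primes above the divisors of Delta_n *)

Lemma Aint_Zint zeta x d : 5.-primitive_root zeta ->
  d \in Zint zeta -> d != 0 -> d * x \in Zint zeta -> x \in Aint -> x \in Zint zeta.
Proof.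
move=> zeta_prim Zd d0 Zdx x_Aint; have [N euclid] := Zint_euclidean zeta_prim.
apply: (euclidean_integrally_closed euclid Zd d0 Zdx (minCpoly_monic x)).
  by apply/polyOverP => i; have /polyOverP/(_ i)/intrP[m ->] := x_Aint; rewrite rpred_int.
exact: root_minCpoly.
Qed.

Lemma lehmer_Delta_gt0 n : 0 < lehmer_Delta n.
Proof.
have := sqr_ge0 (4 * n ^+ 2 + 10 * n + 15); have := sqr_ge0 (2 * n + 5).
by rewrite /lehmer_Delta; nra.
Qed.

Definition lehmer_primes (n : int) : nat_pred := \pi(`|lehmer_Delta n|%N).

Lemma mem_lehmer_primes n p :
  (p \in lehmer_primes n) = prime p && (p %| lehmer_Delta n)%Z.
Proof. by rewrite mem_primes absz_gt0 gt_eqF ?lehmer_Delta_gt0. Qed.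

Lemma int_expf4_mod5 (n : int) : ~~ (5 %| n)%Z -> (5 %| n ^+ 4 - 1)%Z.
Proof.
rewrite !(dvdz_pcharf (pchar_Fp (isT : prime 5))) rmorphB rmorphXn => n0.
rewrite subr_eq0; apply/eqP/(mulfI n0); rewrite -exprS mulr1.
by have := expf_card (n%:~R : 'F_5); rewrite card_Fp.
Qed.

Lemma lehmer_Delta_mod5 n : ~~ (5 %| n)%Z -> (5 %| lehmer_Delta n - 1)%Z.
Proof.
move=> n5; rewrite (_ : _ - 1 = (n ^+ 4 - 1) + 5 * (n ^+ 3 + 3 * n ^+ 2 + 5 * n + 5)).
  by rewrite rpredD ?int_expf4_mod5 // dvdz_mulr.
by rewrite /lehmer_Delta; ring.
Qed.

Lemma A_aut (nu : {rmorphism algC -> algC}) w n : nu (A_ w n) = A_ (nu w) n.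
Proof. by rewrite /A_; ring. Qed.

Lemma prim5_B_A zeta n : 5.-primitive_root zeta -> B_ zeta n = A_ (zeta ^+ 3) n.
Proof. by move=> /prim_expr_order z5; rewrite /A_ /B_; ring: z5. Qed.

Lemma prim5_C_A zeta n : 5.-primitive_root zeta -> C_ zeta n = A_ (zeta ^+ 2) n.
Proof. by move=> /prim_expr_order z5; rewrite /A_ /C_; ring: z5. Qed.

Section SplitPrimes.

Variables (zeta : algC) (n : int).
Hypothesis zeta_prim : 5.-primitive_root zeta.
Hypothesis n_not5 : ~~ (5 %| n)%Z.

Local Notation Z := (Zint zeta).
Local Notation "x %| y" := (y \in sdvd Z x) : ring_scope.
Local Notation A w := (A_ w n).

Lemma A_mem w : w ^+ 5 = 1 -> A w \in Z.
Proof.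
move=> /(unity5_mem_Zint zeta_prim) Zw.
by rewrite /A_ !(rpredD, rpredM, rpredX, rpred1) ?rpred_int.
Qed.

Lemma prod_A w : 5.-primitive_root w ->
  A w * A (w ^+ 2) * A (w ^+ 3) * A (w ^+ 4) = (lehmer_Delta n)%:~R.
Proof.
move=> w_prim; have w4 := prim5_exp4 w_prim.
by rewrite /lehmer_Delta /A_; ring: w4.
Qed.

Lemma prod_A_ord w : 5.-primitive_root w ->
  \prod_(i < 4) A (w ^+ i.+1) = (lehmer_Delta n)%:~R.
Proof.
by move=> w_prim; rewrite !big_ord_recl big_ord0 -(prod_A w_prim) mulr1 !mulrA.
Qed.

Lemma A_dvd_Delta w : 5.-primitive_root w -> A w %| (lehmer_Delta n)%:~R.
Proof.
move=> w_prim; have w5 := prim_expr_order w_prim.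
by rewrite -(prod_A w_prim) -!mulrA sdvd_mulr ?sdvdxx ?rpredM // A_mem // exprAC w5 expr1n.
Qed.

Lemma A_dvd_sub5 w : 5.-primitive_root w ->
  A w %| (n ^+ 3 + 4 * n ^+ 2 + 10 * n + 10)%:~R - 5 * w.
Proof.
move=> w_prim; have w4 := prim5_exp4 w_prim; pose N : algC := n%:~R.
have Zw := unity5_mem_Zint zeta_prim (prim_expr_order w_prim).
have ZN : N \in Z by apply: rpred_int.
apply/sdvdP; exists (3 * N ^+ 2 - 3 * N * A w + A w ^+ 2 + 4 * (2 * N - A w) + 10).
  by rewrite !(rpredD, rpredM, rpredN, rpredX, rpred1).
by rewrite /A_ /N; ring: w4.
Qed.

Variable p : nat.
Hypothesis p_Delta : p \in lehmer_primes n.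

Let p_prime : prime p. Proof. by move: p_Delta; rewrite mem_lehmer_primes => /andP[]. Qed.

Let p_dvd_Delta : (p %| lehmer_Delta n)%Z.
Proof. by move: p_Delta; rewrite mem_lehmer_primes => /andP[]. Qed.

Lemma lehmer_primes_ndvd5 : ~~ (p %| 5)%Z.
Proof.
rewrite dvdzE dvdn_prime2 //; apply/eqP => /= p5.
by move: p_dvd_Delta; rewrite p5 => D5; have := lehmer_Delta_mod5 n_not5; rewrite rpredBl.
Qed.

Lemma exists_residue_root : exists g : int, forall w pi, 5.-primitive_root w ->
  pi %| p%:R -> pi %| A w -> pi %| w - g%:~R.
Proof.
have /coprimezP[[u v] /= uv] : coprimez p 5.
  by rewrite coprimezE prime_coprime // -dvdzE lehmer_primes_ndvd5.
pose h := n ^+ 3 + 4 * n ^+ 2 + 10 * n + 10; exists (v * h) => w pi w_prim pi_p pi_A.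
have -> : w - (v * h)%:~R = (u%:~R * w) * p%:R - v%:~R * (h%:~R - 5 * w).
  have uvC : u%:~R * p%:R + v%:~R * 5 = 1 :> algC.
    by transitivity ((u * p + v * 5)%:~R : algC); [ring | rewrite uv].
  by rewrite rmorphM -[X in X - _]mul1r -{1}uvC; ring.
have Zw := unity5_mem_Zint zeta_prim (prim_expr_order w_prim).
rewrite rpredB //; first by rewrite sdvd_mull ?rpredM ?rpred_int.
by rewrite sdvd_mull ?rpred_int // (sdvd_trans pi_A) // A_dvd_sub5.
Qed.

(* Both [pi] and [pi'] contain [w - g], so that membership of [P.[w]] is decided
   by the divisibility of the integer [P.[g]] by [p]. *)
Lemma sdvd_above_transfer w pi pi' y : 5.-primitive_root w -> ~~ (pi %| 1) ->
    pi %| p%:R -> pi %| A w -> pi' %| p%:R -> pi' %| A w ->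
  y \in Z -> pi %| y -> pi' %| y.
Proof.
move=> w_prim pi1 pi_p pi_A pi'_p pi'_A; rewrite -(Zint_prim5 zeta_prim w_prim).
move=> /ZintP[P ->]; have [g g_root] := exists_residue_root.
have reduce x : x %| p%:R -> x %| A w ->
    (x %| (map_poly intr P).[w]) = (x %| P.[g]%:~R).
  move=> xp xA; apply: sdvdBr; rewrite -horner_map /= sdvd_horner ?rpred_int //.
  - by apply/polyOverP => i; rewrite coef_map rpred_int.
  - exact/(unity5_mem_Zint zeta_prim)/prim_expr_order.
  exact: g_root.
rewrite !reduce // (sdvd_int_of_prime _ p_prime) //= => /dvdzP[k ->].
by rewrite rmorphM sdvd_mull ?rpred_int.
Qed.

Lemma above_root_inj w w' pi : 5.-primitive_root w -> 5.-primitive_root w' ->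
  ~~ (pi %| 1) -> pi %| p%:R -> pi %| A w -> pi %| A w' -> w = w'.
Proof.
move=> w_prim w'_prim pi1 pi_p pi_A pi_A'; have [g g_root] := exists_residue_root.
apply: contraNeq lehmer_primes_ndvd5 => ww'.
rewrite -(sdvd_int_of_prime (S := Zint zeta) _ p_prime pi1 pi_p).
have ww'5 := prim5_sub_dvd5 zeta_prim (prim_expr_order w_prim)
  (prim_expr_order w'_prim) ww'.
apply: sdvd_trans ww'5; rewrite -(subrKA g%:~R) -[_ - w']opprB.
by rewrite rpredB // g_root.
Qed.

Lemma exists_gcd_above w : 5.-primitive_root w -> exists d v,
  [/\ d \in Z, v \in Z, d %| p%:R, d %| A w & p%:R %| d - v * A w].
Proof.
move=> w_prim; have [N euclid] := Zint_euclidean zeta_prim.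
have [d [Zd dp dA [u Zu [v Zv dE]]]] := euclidean_bezout euclid
  (rpred_nat Z p) (A_mem (prim_expr_order w_prim)).
by exists d, v; split; rewrite // dE addrK sdvd_mull ?sdvdxx.
Qed.

Lemma dvd_prod_gcd_above w (d v : 'I_4 -> algC) : 5.-primitive_root w ->
    (forall i, d i \in Z) -> (forall i, v i \in Z) ->
    (forall i, p%:R %| d i - v i * A (w ^+ i.+1)) ->
  p%:R %| \prod_i d i.
Proof.
move=> w_prim Zd Zv d_vA; have w5 := prim_expr_order w_prim.
have ZA i : A (w ^+ i) \in Z by apply: A_mem; rewrite exprAC w5 expr1n.
rewrite (sdvdBr (y := \prod_i (v i * A (w ^+ i.+1)))); last first.
  by apply: sdvd_prodB => // i; rewrite rpredM.
rewrite big_split /= (prod_A_ord w_prim) sdvd_mull ?rpred_prod //.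
by rewrite (Zint_dvd_int (Aint_prim_root zeta_prim) p).
Qed.

(* If the greatest common divisor of [p] and [A w] were a unit, then so would be
   its conjugates, whose product is divisible by [p]. *)
Lemma exists_prime_above w : 5.-primitive_root w ->
  exists pi, common_prime_divisor zeta p (A w) pi.
Proof.
move=> w_prim; have [N euclid] := Zint_euclidean zeta_prim.
have [d [v [Zd Zv dp dA d_vA]]] := exists_gcd_above w_prim.
have d1 : ~~ (d %| 1).
  apply/negP => /sdvdP[q Zq dq].
  have /choice[nu nuE] (i : 'I_4) : exists nu : {rmorphism algC -> algC},
      nu w = w ^+ i.+1.
    by apply: (prim5_aut w_prim); case: i => i ?; apply: prim5_exp.
  have nu_zeta i : nu i zeta \in Z.
    apply: (unity5_mem_Zint zeta_prim).
    by rewrite -rmorphXn (prim_expr_order zeta_prim) rmorph1.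
  have : p%:R %| \prod_i nu i d.
    apply: (dvd_prod_gcd_above (v := fun i => nu i v) w_prim) => [i|i|i].
    - exact: Zint_aut.
    - exact: Zint_aut.
    by have := sdvd_aut (nu_zeta i) d_vA; rewrite rmorphB rmorphM A_aut nuE rmorph_nat.
  have Znuq : \prod_i nu i q \in Z by rewrite rpred_prod // => i _; apply: Zint_aut.
  move=> /(sdvd_mulr Znuq).
  rewrite -big_split big1 => [|i _]; last by rewrite /= -rmorphM -dq rmorph1.
  rewrite (Zint_dvd_nat (Aint_prim_root zeta_prim) p 1) dvdn1 => /eqP p1.
  by move: p_prime; rewrite p1.
have d0 : d != 0.
  apply: contraTneq dp => ->; apply/negP => /sdvdP[q _ /eqP].
  by rewrite mul0r pnatr_eq0 -leqn0 leqNgt prime_gt0.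
have [pi pi_prime pi_d] := prime_divisor euclid Zd d0 d1.
by exists pi; apply/common_prime_divisorP; split=> //; apply: sdvd_trans pi_d _.
Qed.

Local Notation above w pi := (common_prime_divisor zeta p (A w) pi).

Lemma lehmer_primes_mod5 : (p %% 5 = 1)%N.
Proof.
have [pi /common_prime_divisorP[pi_prime pi_p pi_A]] := exists_prime_above zeta_prim.
have [g g_root] := exists_residue_root; have pi1 := sprime_ndvd1 pi_prime.
have z5 := prim_expr_order zeta_prim; have pi_g := g_root _ _ zeta_prim pi_p pi_A.
have pi_gp : pi %| (g ^+ p - g)%:~R.
  rewrite (sdvd_int_of_prime _ p_prime) // (dvdz_pcharf (pchar_Fp p_prime)).
  rewrite rmorphB rmorphXn /= -[X in _ ^+ X](card_Fp p_prime).
  by rewrite expf_card subrr.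
have pi_zp : pi %| zeta ^+ p - zeta.
  have -> : zeta ^+ p - zeta = (zeta ^+ p - g%:~R ^+ p) + (g ^+ p - g)%:~R - (zeta - g%:~R).
    by rewrite rmorphB rmorphXn /=; ring.
  rewrite rpredB // rpredD // -(hornerXn zeta) -(hornerXn g%:~R).
  by rewrite sdvd_horner ?polyOverXn ?rpred_int ?Zint_gen.
apply/eqP; rewrite -[1%N]/(1 %% 5)%N -(eq_prim_root_expr zeta_prim) expr1.
apply: contraR lehmer_primes_ndvd5 => zp_z.
rewrite -(sdvd_int_of_prime (S := Zint zeta) _ p_prime pi1 pi_p).
apply: sdvd_trans pi_zp _; apply: (prim5_sub_dvd5 zeta_prim) => //.
by rewrite exprAC z5 expr1n.
Qed.

Lemma above_associated w pi pi' : 5.-primitive_root w -> above w pi -> above w pi' ->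
  has_valuation Z pi pi' 1.
Proof.
move=> w_prim /common_prime_divisorP[pi_prime pi_p pi_A].
move=> /common_prime_divisorP[pi'_prime pi'_p pi'_A].
have [Zpi Zpi'] := (sprime_mem pi_prime, sprime_mem pi'_prime).
have [pi1 pi'1] := (sprime_ndvd1 pi_prime, sprime_ndvd1 pi'_prime).
have /sdvdP[s Zs pi'E] : pi %| pi'.
  by apply: (sdvd_above_transfer w_prim pi'1); rewrite ?sdvdxx.
have pi'_pi : pi' %| pi by apply: (sdvd_above_transfer w_prim pi1); rewrite ?sdvdxx.
exists s; rewrite ?expr1 // Zs; apply: contra pi1 => pi_s.
move: pi'_pi; rewrite pi'E -[X in X \in _]mulr1 sdvd_pmul2l ?(sprime_neq0 pi_prime) //.
exact: sdvd_trans.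
Qed.

(* [p] divides the product of the greatest common divisors of [p] with the four
   conjugates of [A w]; the first one divides [pi], and [pi] divides no other. *)
Lemma has_valuation_above_prime w pi : 5.-primitive_root w -> above w pi ->
  has_valuation Z pi p%:R 1.
Proof.
move=> w_prim /common_prime_divisorP[pi_prime pi_p pi_A].
have Zpi := sprime_mem pi_prime; have pi1 := sprime_ndvd1 pi_prime.
have /choice[d /choice[v dP]] (i : 'I_4) := exists_gcd_above
  (prim5_exp (k := i.+1) w_prim (ltn_ord i)).
have Zd i : d i \in Z by case: (dP i).
have d0_pi : d 0 %| pi.
  by have [_ _ dp dA _] := dP 0; apply: (sdvd_above_transfer w_prim pi1); rewrite ?sdvdxx.
have d_npi (i : 'I_4) : i != 0 -> ~~ (pi %| d i).
  have [_ _ dp dA _] := dP i; apply: contraNN => pi_d; have i5 := ltn_ord i.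
  have /esym/eqP : w = w ^+ i.+1.
    apply: (above_root_inj _ _ pi1 pi_p) => //; last exact: sdvd_trans dA.
    exact: (prim5_exp w_prim).
  by rewrite -{2}[w]expr1 (eq_prim_root_expr w_prim) !modn_small.
have /sdvdP[t Zt pE] := pi_p; exists t; rewrite ?expr1 // Zt /=.
apply/negP => pi_t; pose y := \prod_(i < 3) d (lift ord0 i).
have Zy : y \in Z by apply: rpred_prod.
have /(sprime_dvd_prod pi_prime)[//|i] : pi %| y.
  apply: sdvd_trans pi_t _; rewrite -(sdvd_pmul2l (sprime_neq0 pi_prime)) -pE.
  apply: sdvd_trans (_ : p%:R %| \prod_i d i) _.
    apply: (dvd_prod_gcd_above (v := v) w_prim) => // i; by case: (dP i).
  by rewrite big_ord_recl sdvd_mul ?sdvdxx.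
by apply/negP/d_npi; rewrite eq_sym neq_lift.
Qed.

Lemma has_valuation_above_nat w pi m : 5.-primitive_root w -> above w pi ->
  (0 < m)%N -> has_valuation Z pi m%:R (logn p m).
Proof.
move=> w_prim pi_above m0; have vp := has_valuation_above_prime w_prim pi_above.
have /common_prime_divisorP[pi_prime pi_p _] := pi_above.
have [k pk ->] := pfactor_coprime p_prime m0.
rewrite logn_Gauss // pfactorK // natrM natrX -[logn p m]add0n.
rewrite -[X in has_valuation _ _ _ (_ + X)]muln1.
apply: has_valuationM (has_valuationX pi_prime _ vp) => //.
apply: has_valuation_ndvd; first exact: rpred_nat.
rewrite (sdvd_int_of_prime k p_prime (sprime_ndvd1 pi_prime) pi_p) dvdzE /=.
by rewrite -prime_coprime.
Qed.

Lemma has_valuation_above_conj w w' pi : 5.-primitive_root w ->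
    5.-primitive_root w' -> w != w' -> above w pi ->
  has_valuation Z pi (A w') 0.
Proof.
move=> w_prim w'_prim ww' /common_prime_divisorP[pi_prime pi_p pi_A].
apply: has_valuation_ndvd; first exact/A_mem/prim_expr_order.
by apply: contraNN ww' => /(above_root_inj _ _ (sprime_ndvd1 pi_prime) pi_p pi_A) ->.
Qed.

Lemma has_valuation_above_A w pi : 5.-primitive_root w -> above w pi ->
  has_valuation Z pi (A w) (logn p `|lehmer_Delta n|).
Proof.
move=> w_prim pi_above; have [N euclid] := Zint_euclidean zeta_prim.
have /common_prime_divisorP[pi_prime _ _] := pi_above.
have vconj k : (1 < k < 5)%N -> has_valuation Z pi (A (w ^+ k)) 0.
  move=> /andP[k1 k5]; have wk_prim := prim5_exp (k := k) w_prim.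
  apply: (has_valuation_above_conj w_prim) pi_above; first by apply: wk_prim; rewrite ltnW.
  by rewrite -{1}[w]expr1 (eq_prim_root_expr w_prim) !modn_small // ltn_eqF.
have D0 : (0 < `|lehmer_Delta n|)%N by rewrite absz_gt0 gt_eqF ?lehmer_Delta_gt0.
have := has_valuation_above_nat w_prim pi_above D0.
rewrite -[_%:R]/(`|lehmer_Delta n|%N%:Z%:~R) gtz0_abs ?lehmer_Delta_gt0 //.
rewrite -(prod_A w_prim) -!mulrA [A w * _]mulrC => vD; rewrite -[logn _ _]subn0.
apply: (has_valuation_divl euclid pi_prime _ _ vD).
  exact/A_mem/prim_expr_order.
exact: (has_valuationM pi_prime (vconj 2%N isT)
  (has_valuationM pi_prime (vconj 3%N isT) (vconj 4%N isT))).
Qed.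

End SplitPrimes.

(** * Residues modulo 1 - zeta *)

Section Residue.

Variable zeta : algC.
Hypothesis zeta_prim : 5.-primitive_root zeta.

Let z4 := prim5_exp4 zeta_prim.

Local Notation Z := (Zint zeta).
Local Notation "x %| y" := (y \in sdvd Z x) : ring_scope.
Local Notation golden := ((1 + sqrtC 5) / 2 : algC).

Lemma one_sub_zeta_dvd5 : 1 - zeta %| 5.
Proof.
have z5 := prim_expr_order zeta_prim.
apply: (prim5_sub_dvd5 zeta_prim); rewrite ?expr1n //.
by rewrite eq_sym -[zeta]expr1 -(prim_order_dvd zeta_prim).
Qed.

Lemma one_sub_zeta_ndvd1 : ~~ (1 - zeta %| 1).
Proof.
apply/negP => /(sdvd_exp2r 4); rewrite expr1n => lambda4.
have five_dvd : 5 %| (1 - zeta) ^+ 4.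
  apply/sdvdP; exists (- zeta + zeta ^+ 2 - zeta ^+ 3); last by ring: z4.
  by rewrite !(rpredD, rpredN, rpredX) ?Zint_gen.
have := sdvd_trans five_dvd lambda4.
by rewrite (Zint_dvd_nat (Aint_prim_root zeta_prim) 5 1).
Qed.

Lemma one_sub_zeta_dvd_int (m : int) : (1 - zeta %| m%:~R) = (5 %| m)%Z.
Proof.
exact: (sdvd_int_of_prime m (isT : prime 5) one_sub_zeta_ndvd1 one_sub_zeta_dvd5).
Qed.

Lemma one_sub_zeta_dvd_sub1 w : w ^+ 5 = 1 -> 1 - zeta %| w - 1.
Proof.
move=> /(prim_rootP zeta_prim)[k ->].
have lambda_zeta : 1 - zeta %| zeta - 1 by rewrite -(opprB 1 zeta) rpredN sdvdxx.
have := sdvd_horner (polyOverXn (Zint zeta) k) (Zint_gen zeta) (rpred1 _) lambda_zeta.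
by rewrite !hornerXn expr1n.
Qed.

Lemma cubic_at_residue (u0 u1 u2 u3 : int) :
  1 - zeta %| cubic_at zeta u0%:~R u1%:~R u2%:~R u3%:~R - (u0 + u1 + u2 + u3)%:~R.
Proof.
have dvd_exp k (u : int) : 1 - zeta %| u%:~R * (zeta ^+ k - 1).
  rewrite sdvd_mull ?rpred_int // one_sub_zeta_dvd_sub1 //.
  by rewrite exprAC (prim_expr_order zeta_prim) expr1n.
rewrite (_ : _ - _ = u1%:~R * (zeta ^+ 1 - 1) + u2%:~R * (zeta ^+ 2 - 1)
    + u3%:~R * (zeta ^+ 3 - 1)); last by rewrite /cubic_at; ring.
by rewrite !rpredD.
Qed.

Lemma nonzero_residueP x : x \in Z -> ~~ (1 - zeta %| x) ->
  [|| 1 - zeta %| x - 1, 1 - zeta %| x - -1, 1 - zeta %| x - 2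
    | 1 - zeta %| x - - 2].
Proof.
move=> /(Zint_cubicP zeta_prim)[u0 [u1 [u2 [u3 xE]]]].
have := cubic_at_residue u0 u1 u2 u3; rewrite -xE.
move: (u0 + u1 + u2 + u3) => s x_s; rewrite (sdvdBr x_s) one_sub_zeta_dvd_int => s5.
have residueE (r : int) : (1 - zeta %| x - r%:~R) = (5 %| s - r)%Z.
  rewrite -one_sub_zeta_dvd_int rmorphB; apply: sdvdBr.
  by rewrite (_ : _ - _ = x - s%:~R) //; ring.
by have := (residueE 1, residueE (-1), residueE 2, residueE (-2)) => -[[[-> ->] ->] ->]; lia.
Qed.

(* [golden] is a root of X^2 - X - 1, as are [- zeta - zeta^4] and
   [- zeta^2 - zeta^3]. *)
Lemma golden_prim5 : exists2 w, 5.-primitive_root w & golden = - w - w ^+ 4.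
Proof.
have z5 := prim_expr_order zeta_prim.
have : (sqrtC 5 : algC) ^+ 2 == (1 + 2 * zeta + 2 * zeta ^+ 4) ^+ 2.
  by rewrite sqrtCK; apply/eqP; ring: z4.
rewrite eqf_sqr => /orP[] /eqP->; [exists (zeta ^+ 2) | exists zeta] => //.
- exact: prim5_exp.
- by field: z4.
by field.
Qed.

Lemma golden_unit : [/\ golden \in Z, golden %| 1 & 1 - zeta %| golden - 3].
Proof.
have [w w_prim ->] := golden_prim5; have w5 := prim_expr_order w_prim.
have w4 := prim5_exp4 w_prim; have Zw := unity5_mem_Zint zeta_prim w5.
split; first by rewrite !(rpredD, rpredN, rpredX).
  apply/sdvdP; exists (- w - w ^+ 4 - 1); last by ring: w4.
  by rewrite !(rpredD, rpredN, rpredX, rpred1).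
rewrite (_ : _ - 3 = - (w - 1) - (w ^+ 4 - 1) - 5); last by ring.
rewrite rpredB ?one_sub_zeta_dvd5 // rpredB ?rpredN ?one_sub_zeta_dvd_sub1 //.
by rewrite exprAC w5 expr1n.
Qed.

Lemma u_spec x : x \in Z -> ~~ (1 - zeta %| x) ->
  [/\ u_ zeta x \in Z, u_ zeta x %| 1 & 1 - zeta %| u_ zeta x * x - 1].
Proof.
move=> Zx /(nonzero_residueP Zx) x_residue; have [Zphi phi1 phi3] := golden_unit.
have d5 := one_sub_zeta_dvd5; have N1_1 : -1 %| 1.
  by apply/sdvdP; exists (-1); rewrite ?rpredN ?rpred1 ?mulrNN ?mulr1.
have residueE r : `[< Zzeta_residue zeta x r >] = (1 - zeta %| x - r).
  by apply/asboolP/Zzeta_dvdP.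
move: x_residue; rewrite /u_ !residueE.
case: ifPn => [x1 _|_]; first by rewrite mul1r rpred1 sdvdxx.
case: ifPn => [x1 _|_].
  by rewrite rpredN rpred1; split=> //; rewrite (_ : _ - 1 = - (x - -1)) ?rpredN //; ring.
case: ifPn => [x2 _|_]; [split=> // | case: ifPn => [x2 _|//]; split].
- set phi := _ / _ in Zphi phi3 *.
  rewrite (_ : _ - 1 = phi * (x - 2) + 2 * (phi - 3) + 5); last by ring.
  by apply: rpredD => //; apply: rpredD; rewrite sdvd_mull ?rpred_nat.
- by rewrite rpredN.
- by have := sdvd_mul N1_1 phi1; rewrite mulN1r mulr1.
set phi := _ / _ in Zphi phi3 *.
rewrite (_ : _ - 1 = - (phi * (x - - 2)) + 2 * (phi - 3) + 5); last by ring.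
by apply: rpredD => //; apply: rpredD; rewrite ?rpredN sdvd_mull ?rpred_nat.
Qed.

Lemma residue1M x y : y \in Z -> 1 - zeta %| x - 1 -> 1 - zeta %| y - 1 ->
  1 - zeta %| x * y - 1.
Proof.
move=> Zy x1 y1; rewrite (_ : _ - 1 = (x - 1) * y + (y - 1)); last by ring.
by rewrite rpredD // sdvd_mulr.
Qed.

End Residue.

(** * Factorization at the primes dividing Delta_n *)

Lemma pnat_ind (rho : nat_pred) (Q : nat -> Prop) :
    Q 1%N ->
    (forall p m, p \in rho -> rho.-nat m -> Q m -> Q (p * m)%N) ->
  forall m, rho.-nat m -> Q m.
Proof.
move=> Q1 QM; elim/ltn_ind => m IH rho_m; have m0 : (0 < m)%N by case/andP: rho_m.
have [m1|m1] := leqP m 1; first by rewrite (_ : m = 1)%N //; lia.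
have /dvdnP[k mE] := pdiv_dvd m; rewrite mulnC in mE.
move: (rho_m); rewrite mE pnatM pnatE ?pdiv_prime // => /andP[rho_p rho_k].
apply: QM => //; apply: IH => //; rewrite [X in (_ < X)%N]mE ltn_Pmull ?prime_gt1 ?pdiv_prime //.
by case/andP: rho_k.
Qed.

Lemma logn_prod (I : finType) p (f : I -> nat) : (forall i, 0 < f i)%N ->
  logn p (\prod_i f i)%N = (\sum_i logn p (f i))%N.
Proof.
move=> f0; suff [] : (0 < \prod_i f i)%N /\
    logn p (\prod_i f i)%N = (\sum_i logn p (f i))%N by [].
elim/big_rec2: _ => [|i x y _ [x0 <-]]; first by rewrite logn1.
by rewrite muln_gt0 f0 x0 lognM.
Qed.

Lemma lehmer_pnat_mod5 n m : ~~ (5 %| n)%Z -> (lehmer_primes n).-nat m ->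
  (m %% 5 = 1)%N.
Proof.
move=> n_not5; have [zeta zeta_prim] := C_prim_root_exists (isT : (0 < 5)%N).
move: m; apply: pnat_ind => // p m p_Delta _ IH.
by rewrite -modnMml (lehmer_primes_mod5 zeta_prim n_not5 p_Delta) mul1n.
Qed.

(* The valuations of [x] at the primes above the divisors of Delta_n, indexed by
   the rational prime [p] and the root [w] such that the prime divides [A_ w n]. *)
Definition local_exponents (zeta : algC) (n : int) (x : algC)
    (v : nat -> algC -> nat) : Prop :=
  forall p w pi, p \in lehmer_primes n -> 5.-primitive_root w ->
    common_prime_divisor zeta p (A_ w n) pi ->
  has_valuation (Zint zeta) pi x (v p w).

Section LocalExponents.

Variables (zeta : algC) (n : int).
Hypothesis zeta_prim : 5.-primitive_root zeta.
Hypothesis n_not5 : ~~ (5 %| n)%Z.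

Local Notation Z := (Zint zeta).
Local Notation "x %| y" := (y \in sdvd Z x) : ring_scope.
Local Notation A w := (A_ w n).
Local Notation exponents x v := (local_exponents zeta n x v).
Local Notation Delta_nat m := ((lehmer_primes n).-nat m).

Lemma local_exponentsM x y u v : exponents x u -> exponents y v ->
  exponents (x * y) (fun p w => u p w + v p w)%N.
Proof.
move=> vx vy p w pi p_Delta w_prim pi_above.
have /common_prime_divisorP[pi_prime _ _] := pi_above.
by apply: has_valuationM => //; [apply: vx | apply: vy].
Qed.

Lemma local_exponentsX x v k : exponents x v ->
  exponents (x ^+ k) (fun p w => k * v p w)%N.
Proof.
move=> vx p w pi p_Delta w_prim pi_above.
have /common_prime_divisorP[pi_prime _ _] := pi_above.
by apply: has_valuationX => //; apply: vx.
Qed.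

Lemma local_exponentsN x v : exponents x v -> exponents (- x) v.
Proof.
by move=> vx p w pi p_Delta w_prim pi_above; apply/has_valuationN/vx.
Qed.

Lemma local_exponents_nat m : (0 < m)%N ->
  exponents m%:R (fun p _ => logn p m).
Proof.
move=> m0 p w pi p_Delta w_prim pi_above.
exact: (has_valuation_above_nat zeta_prim n_not5 p_Delta w_prim).
Qed.

Lemma local_exponents_A w : 5.-primitive_root w ->
  exponents (A w) (fun p w' => (w == w') * logn p `|lehmer_Delta n|)%N.
Proof.
move=> w_prim p w' pi p_Delta w'_prim pi_above; case: eqVneq => [->|ww'].
  rewrite mul1n; exact: (has_valuation_above_A zeta_prim n_not5 p_Delta).
rewrite eq_sym in ww'; rewrite mul0n.
exact: (has_valuation_above_conj zeta_prim n_not5 p_Delta w'_prim).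
Qed.

Lemma local_exponents_divl x y u v : y \in Z -> exponents x u ->
  exponents (x * y) v -> exponents y (fun p w => v p w - u p w)%N.
Proof.
move=> Zy vx vxy p w pi p_Delta w_prim pi_above.
have [N euclid] := Zint_euclidean zeta_prim.
have /common_prime_divisorP[pi_prime _ _] := pi_above.
by apply: (has_valuation_divl euclid) => //; [apply: vx | apply: vxy].
Qed.

Lemma sprime_above pi m : sprime Z pi -> Delta_nat m -> pi %| m%:R ->
  exists p w, [/\ p \in lehmer_primes n, 5.-primitive_root w
    & common_prime_divisor zeta p (A w) pi].
Proof.
move=> pi_prime; move: m; apply: pnat_ind => [/(negP (sprime_ndvd1 pi_prime))|] //.
move=> p m p_Delta _ IH; rewrite natrM sprime_dvdM ?rpred_nat // => /orP[pi_p|//].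
have ZA (i : 'I_4) : A (zeta ^+ i.+1) \in Z.
  by apply: (A_mem n zeta_prim); rewrite exprAC (prim_expr_order zeta_prim) expr1n.
have /(sprime_dvd_prod pi_prime ZA)[i pi_A] : pi %| \prod_(i < 4) A (zeta ^+ i.+1).
  rewrite (prod_A_ord n zeta_prim) (sdvd_trans pi_p) //.
  rewrite (Zint_dvd_int (Aint_prim_root zeta_prim) p).
  by move: p_Delta; rewrite mem_lehmer_primes => /andP[].
exists p, (zeta ^+ i.+1); split=> //; last exact/common_prime_divisorP.
exact: (prim5_exp (k := i.+1) zeta_prim (ltn_ord i)).
Qed.

Lemma exists_prime_above_pnat m p w : Delta_nat m -> 5.-primitive_root w ->
  prime p -> (p %| m)%N -> exists pi, common_prime_divisor zeta p (A w) pi.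
Proof.
move=> m_Delta w_prim p_prime p_m; have := pnat_dvd p_m m_Delta.
by rewrite pnatE // => p_Delta; apply: (exists_prime_above zeta_prim p_Delta).
Qed.

Lemma sdvd_of_local_exponents m x v : Delta_nat m -> x \in Z -> exponents x v ->
    (forall p w, p \in lehmer_primes n -> 5.-primitive_root w ->
      (logn p m <= v p w)%N) ->
  m%:R %| x.
Proof.
move=> m_Delta Zx vx m_v; have [N euclid] := Zint_euclidean zeta_prim.
have m0 : (0 < m)%N by case/andP: m_Delta.
apply: (sdvd_local euclid (rpred_nat _ m) Zx) => [|pi e pi_prime ve].
  by rewrite pnatr_eq0 -lt0n.
case: e ve => [|e] ve; first by apply/sdvdP; exists x; rewrite ?mul1r.
have pi_m : pi %| m%:R by rewrite -[pi]expr1 (has_valuation_dvd pi_prime _ ve).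
have [p [w [p_Delta w_prim pi_above]]] := sprime_above pi_prime m_Delta pi_m.
have vm := local_exponents_nat m0 p_Delta w_prim pi_above.
rewrite (has_valuation_dvd pi_prime _ (vx p w pi p_Delta w_prim pi_above)).
by rewrite -(has_valuation_inj pi_prime vm ve) m_v.
Qed.

Lemma power_free_of_local_exponents m x v k : Delta_nat m -> x \in Z ->
    x %| m%:R -> exponents x v -> (0 < k)%N ->
    (forall p w, p \in lehmer_primes n -> 5.-primitive_root w -> (v p w < k)%N) ->
  forall z, z \in Z -> z ^+ k %| x -> z %| 1.
Proof.
move=> m_Delta Zx xm vx k0 v_k z Zz zx; apply: contraT => z1.
have [N euclid] := Zint_euclidean zeta_prim.
have zk_m := sdvd_trans zx xm.
have z0 : z != 0.
  apply: contraTneq zk_m => ->; rewrite expr0n (gtn_eqF k0).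
  apply/negP => /sdvdP[q _ /eqP]; rewrite mul0r pnatr_eq0.
  by case/andP: m_Delta => /lt0n_neq0/negPf->.
have [pi pi_prime pi_z] := prime_divisor euclid Zz z0 z1.
have pik_x := sdvd_trans (sdvd_exp2r k pi_z) zx.
have pi_m : pi %| m%:R.
  apply: sdvd_trans xm; apply: sdvd_trans pik_x.
  exact: (sdvd_exp2l (m := 1) (sprime_mem pi_prime)).
have [p [w [p_Delta w_prim pi_above]]] := sprime_above pi_prime m_Delta pi_m.
have := pik_x; rewrite (has_valuation_dvd pi_prime _ (vx p w pi p_Delta w_prim pi_above)).
by rewrite leqNgt v_k.
Qed.

Lemma local_exponents_choice m w l (ps : 'I_l -> nat) (pis : 'I_l -> algC) :
    5.-primitive_root w -> prime_element_choice zeta m (A w) ps pis ->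
  exponents (\prod_i pis i) (fun p w' => (w == w') * logn p m)%N.
Proof.
move=> w_prim [-> ps_prime pisP] p w' pi p_Delta w'_prim pi_above.
have p_prime : prime p by move: p_Delta; rewrite mem_lehmer_primes => /andP[].
have /common_prime_divisorP[pi_prime pi_p _] := pi_above.
rewrite logn_prod => [|i]; last exact: prime_gt0.
rewrite big_distrr /=; apply: has_valuation_prod => // i.
have pis_above := pisP i; have /common_prime_divisorP[pis_prime pis_p pis_A] := pis_above.
have Zpis := sprime_mem pis_prime; have pi1 := sprime_ndvd1 pi_prime.
rewrite logn_prime //; case: (eqVneq p (ps i)) => [pE|p_ps]; last first.
  rewrite muln0; apply: has_valuation_ndvd => //.
  apply: contra p_ps => /sdvd_trans/(_ pis_p).
  by rewrite (sdvd_int_of_prime (ps i) p_prime pi1 pi_p) dvdzE /= dvdn_prime2.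
rewrite -pE in pis_above pis_p; rewrite muln1; case: (eqVneq w w') => [wE|ww'].
  rewrite -wE in pi_above; exact: (above_associated _ _ _ w_prim pi_above).
apply: has_valuation_ndvd => //; apply: contra ww' => /sdvd_trans/(_ pis_A) pi_A.
have /common_prime_divisorP[_ _ pi_A'] := pi_above.
by rewrite (above_root_inj zeta_prim n_not5 p_Delta w_prim w'_prim pi1 pi_p pi_A pi_A').
Qed.

Lemma normalized_choice_spec m w l (ps : 'I_l -> nat) (pis : 'I_l -> algC) :
    5.-primitive_root w -> Delta_nat m ->
    prime_element_choice zeta m (A w) ps pis ->
  let x := u_ zeta (\prod_i pis i) * \prod_i pis i in
  [/\ x \in Z, 1 - zeta %| x - 1, x %| m%:R
    & exponents x (fun p w' => (w == w') * logn p m)%N].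
Proof.
move=> w_prim m_Delta choice_m; have [mE ps_prime pisP] := choice_m.
have pis_p i : pis i %| (ps i)%:R by have /common_prime_divisorP[] := pisP i.
have Zpis i : pis i \in Z by have /common_prime_divisorP[/sprime_mem] := pisP i.
set lam := \prod_i pis i; have Zlam : lam \in Z by rewrite rpred_prod.
have lam_m : lam %| m%:R.
  rewrite mE natr_prod /lam; elim/big_ind2: _ => [|*|i _] //; first exact: sdvdxx.
  exact: sdvd_mul.
have lam_residue : ~~ (1 - zeta %| lam).
  apply/negP => /sdvd_trans/(_ lam_m).
  rewrite (one_sub_zeta_dvd_int zeta_prim m) dvdzE /dvdn /=.
  by rewrite (lehmer_pnat_mod5 n_not5 m_Delta).
have [Zu u1 u_lam] := u_spec zeta_prim Zlam lam_residue.
split=> //; first exact: rpredM; first by rewrite -[m%:R]mul1r sdvd_mul.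
move=> p w' pi p_Delta w'_prim pi_above; rewrite -[(_ * _)%N]add0n.
have /common_prime_divisorP[pi_prime _ _] := pi_above.
apply: has_valuationM => //; first exact: has_valuation_unit.
exact: (local_exponents_choice w_prim choice_m).
Qed.

End LocalExponents.

Lemma squarefree_logn p m : prime p -> squarefree m -> (logn p m <= 1)%N.
Proof.
move=> p_prime m_sqfree; rewrite leqNgt; apply/negP => p2_m.
have m0 : (0 < m)%N by rewrite lt0n; apply: contraTneq p2_m => ->; rewrite logn0.
have := m_sqfree p; rewrite pfactor_dvdn // => /(_ p2_m) p1.
by move: p_prime; rewrite p1.
Qed.

Lemma coprime_minn_logn p x y : (0 < x)%N -> (0 < y)%N -> coprime x y ->
  minn (logn p x) (logn p y) = 0%N.
Proof. by move=> x0 y0 /eqP xy; rewrite -logn_gcd // xy logn1. Qed.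

Section Theta.

Variables (zeta : algC) (n : int) (a b c d e : nat).
Hypothesis zeta_prim : 5.-primitive_root zeta.
Hypothesis n_not5 : ~~ (5 %| n)%Z.
Hypothesis Delta_eq : lehmer_Delta n = (a * b ^ 2 * c ^ 3 * d ^ 4 * e ^ 5)%N%:Z.
Hypothesis abcde_gt0 : [&& 0 < a, 0 < b, 0 < c, 0 < d & 0 < e]%N.
Hypothesis abcd_sqfree :
  [/\ squarefree a, squarefree b, squarefree c & squarefree d].
Hypothesis abcd_coprime : pairwise coprime [:: a; b; c; d].

Local Notation Z := (Zint zeta).
Local Notation "x %| y" := (y \in sdvd Z x) : ring_scope.
Local Notation A w := (A_ w n).
Local Notation exponents x v := (local_exponents zeta n x v).
Local Notation Delta_nat m := ((lehmer_primes n).-nat m).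
Local Notation N1 := (b * c ^ 2 * d ^ 3 * e ^ 3)%N.
Local Notation N2 := (b * c * d ^ 2 * e ^ 2)%N.
Local Notation N3 := (c * d * e)%N.
Local Notation M := (b * c ^ 2 * d ^ 3 * e ^ 4)%N.

Let Delta_nat_bcde : [/\ Delta_nat b, Delta_nat c, Delta_nat d & Delta_nat e].
Proof.
have : Delta_nat `|lehmer_Delta n|%N by rewrite pnat_pi // absz_gt0 gt_eqF ?lehmer_Delta_gt0.
by rewrite Delta_eq absz_nat !(pnatX, pnatM) !orbF => /andP[/andP[/andP[/andP[_ ->] ->] ->] ->].
Qed.

Lemma Delta_nat_numerators :
  [/\ Delta_nat N1, Delta_nat N2, Delta_nat N3 & Delta_nat M].
Proof.
case: Delta_nat_bcde => b_D c_D d_D e_D.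
by rewrite !(pnatX, pnatM) b_D c_D d_D e_D.
Qed.

Lemma logn_abcd p : prime p ->
  (logn p a + logn p b + logn p c + logn p d <= 1)%N.
Proof.
move=> p_prime; case/and5P: abcde_gt0 => a0 b0 c0 d0 _.
case: abcd_sqfree => /(squarefree_logn p_prime) a1 /(squarefree_logn p_prime) b1.
move=> /(squarefree_logn p_prime) c1 /(squarefree_logn p_prime) d1.
move: abcd_coprime => /= /and4P[/and4P[ab ac ad _] /and3P[bc bd _] /andP[cd _] _].
have bound va vb vc vd : (va <= 1 -> vb <= 1 -> vc <= 1 -> vd <= 1 ->
    minn va vb = 0 -> minn va vc = 0 -> minn va vd = 0 -> minn vb vc = 0 ->
    minn vb vd = 0 -> minn vc vd = 0 -> va + vb + vc + vd <= 1)%N.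
  by case: va vb vc vd => [|[|va]] [|[|vb]] [|[|vc]] [|[|vd]].
by apply: bound => //; apply: coprime_minn_logn.
Qed.

Definition theta_exponent (p : nat) (w : algC) : nat :=
  let D := logn p `|lehmer_Delta n| in
  (5 * ((zeta == w) * logn p N1 + (zeta ^+ 3 == w) * logn p N2
        + (zeta ^+ 2 == w) * logn p N3)
   + ((zeta == w) * D + 2 * ((zeta ^+ 3 == w) * D)
      + 3 * ((zeta ^+ 2 == w) * D) + 4 * ((zeta ^+ 4 == w) * D)))%N.

(* At the four primes above [p] the exponents of A_n B_n^2 C_n^3 D_n^4 are
   l, 2l, 3l and 4l with l = logn p Delta_n, and those of the fifth powers of
   the alpha_i bring them to the residues modulo 5. *)
Lemma theta_exponent_bounds p w : prime p -> 5.-primitive_root w ->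
  (5 * logn p M <= theta_exponent p w < 5 * logn p M + 5)%N.
Proof.
move=> p_prime w_prim; have := logn_abcd p_prime.
case/and5P: abcde_gt0 => a0 b0 c0 d0 e0; rewrite /theta_exponent Delta_eq absz_nat.
rewrite !(lognM, lognX) ?muln_gt0 ?expn_gt0 ?a0 ?b0 ?c0 ?d0 ?e0 //.
move: (logn p a) (logn p b) (logn p c) (logn p d) (logn p e) => va vb vc vd ve.
have [k wE] := prim_rootP zeta_prim (prim_expr_order w_prim).
have k0 : (0 < k)%N.
  rewrite lt0n; apply: contraTneq w_prim => k0; rewrite wE k0 expr0.
  by apply/negP => /(prim_order_dvd (R := algC))/(_ 1%N); rewrite expr1 eqxx.
have zetaE j : (zeta ^+ j == w) = (j == k %[mod 5])%N.
  by rewrite wE (eq_prim_root_expr zeta_prim).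
have := zetaE 1%N; rewrite expr1 => ->; rewrite !zetaE.
case: k {wE zetaE} k0 => [[|[|[|[|[|]]]]]] //= _ _;
  by rewrite ?(mul0n, mul1n, muln0, addn0, add0n) => *; lia.
Qed.

Section Numerator.

Variables alpha1 alpha2 alpha3 : algC.
Hypotheses (Zalpha1 : alpha1 \in Z) (Zalpha2 : alpha2 \in Z) (Zalpha3 : alpha3 \in Z).
Hypotheses (alpha1_N1 : alpha1 %| N1%:R) (alpha2_N2 : alpha2 %| N2%:R).
Hypothesis alpha3_N3 : alpha3 %| N3%:R.
Hypothesis exponents1 : exponents alpha1 (fun p w => (zeta == w) * logn p N1)%N.
Hypothesis exponents2 : exponents alpha2 (fun p w => (zeta ^+ 3 == w) * logn p N2)%N.
Hypothesis exponents3 : exponents alpha3 (fun p w => (zeta ^+ 2 == w) * logn p N3)%N.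

Let numerator := (alpha1 * alpha2 * alpha3) ^+ 5 *
  - (A zeta * A (zeta ^+ 3) ^+ 2 * A (zeta ^+ 2) ^+ 3 * A (zeta ^+ 4) ^+ 4).

Let M_Delta : Delta_nat M. Proof. by case: Delta_nat_numerators. Qed.

Let numerator_exponents : exponents numerator theta_exponent.
Proof.
have A_exponents k : (0 < k < 5)%N -> exponents (A (zeta ^+ k))
    (fun p w => (zeta ^+ k == w) * logn p `|lehmer_Delta n|)%N.
  by move=> k5; apply: local_exponents_A => //; apply: prim5_exp.
apply: (local_exponentsM (local_exponentsX 5 (local_exponentsM
  (local_exponentsM exponents1 exponents2) exponents3))).
apply/local_exponentsN; apply: (local_exponentsM (local_exponentsM
  (local_exponentsM (A_exponents 1%N isT) (local_exponentsX 2 (A_exponents 3%N isT)))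
  (local_exponentsX 3 (A_exponents 2%N isT))) (local_exponentsX 4 (A_exponents 4%N isT))).
Qed.

Let numerator_mem : numerator \in Z.
Proof.
have ZA k : A (zeta ^+ k) \in Z.
  by apply: (A_mem n zeta_prim); rewrite exprAC (prim_expr_order zeta_prim) expr1n.
by rewrite rpredM ?rpredN ?rpredX ?rpredM ?rpredX ?ZA // (ZA 1%N).
Qed.

Let numerator_dvd : numerator %| ((N1 * N2 * N3) ^ 5 * `|lehmer_Delta n| ^ 10)%N%:R.
Proof.
have A_dvd k : (0 < k < 5)%N -> A (zeta ^+ k) %| `|lehmer_Delta n|%N%:R.
  move=> k5; rewrite -[_%:R]/(`|lehmer_Delta n|%N%:Z%:~R) gtz0_abs ?lehmer_Delta_gt0 //.
  by apply: A_dvd_Delta => //; apply: prim5_exp.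
rewrite (natrM _ (_ ^ 5)) !natrX (natrM _ (N1 * N2)) (natrM _ N1).
apply: sdvd_mul; first by rewrite sdvd_exp2r ?sdvd_mul.
rewrite sdvdNl (exprD _ 6 4) (exprD _ 3 3) (exprD _ 1 2).
by rewrite !sdvd_mul ?sdvd_exp2r ?A_dvd // (A_dvd 1%N).
Qed.

Lemma theta_exists : exists theta, [/\ theta \in Z,
    forall z, z \in Z -> z ^+ 5 %| theta -> z %| 1
  & (alpha1 * alpha2 * alpha3) ^+ 5 *
    - (A zeta * A (zeta ^+ 3) ^+ 2 * A (zeta ^+ 2) ^+ 3 * A (zeta ^+ 4) ^+ 4) =
    M%:R ^+ 5 * theta].
Proof.
have M_gt0 : (0 < M)%N by case/andP: M_Delta.
have bounds p w : p \in lehmer_primes n -> 5.-primitive_root w ->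
    (logn p (M ^ 5) <= theta_exponent p w < logn p (M ^ 5) + 5)%N.
  rewrite mem_lehmer_primes lognX => /andP[p_prime _]; exact: theta_exponent_bounds.
have /sdvdP[theta Ztheta thetaE] : (M ^ 5)%N%:R %| numerator.
  apply: (sdvd_of_local_exponents zeta_prim n_not5 _ _ numerator_exponents) => //.
    by rewrite pnatX M_Delta.
  by move=> p w p_Delta /(bounds _ _ p_Delta)/andP[].
exists theta; split=> //; last by rewrite -/numerator thetaE natrX.
have theta_dvd : theta %| ((N1 * N2 * N3) ^ 5 * `|lehmer_Delta n| ^ 10)%N%:R.
  by apply: sdvd_trans numerator_dvd; rewrite thetaE sdvd_mull ?rpred_nat ?sdvdxx.
have theta_exponents : exponents theta
    (fun p w => theta_exponent p w - logn p (M ^ 5))%N.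
  have M5_exponents := local_exponents_nat zeta_prim n_not5 (_ : 0 < M ^ 5)%N.
  apply: (local_exponents_divl zeta_prim Ztheta (M5_exponents _)).
    by rewrite expn_gt0 M_gt0.
  by rewrite -thetaE.
have theta_lt5 p w : p \in lehmer_primes n -> 5.-primitive_root w ->
    (theta_exponent p w - logn p (M ^ 5) < 5)%N.
  by move=> p_Delta /(bounds _ _ p_Delta)/andP[? ?]; rewrite ltn_subLR.
apply: (power_free_of_local_exponents (k := 5) zeta_prim _ Ztheta theta_dvd theta_exponents
  isT theta_lt5).
case: Delta_nat_numerators => N1_D N2_D N3_D _.
rewrite pnatM !pnatX (pnatM _ (N1 * N2)) (pnatM _ N1) N1_D N2_D N3_D /= pnat_pi //.
by rewrite absz_gt0 gt_eqF ?lehmer_Delta_gt0.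
Qed.

End Numerator.

Lemma normalized_choices_spec k (p : 'I_k -> nat) (pi : 'I_k -> algC)
    r (q : 'I_r -> nat) (pi' : 'I_r -> algC) w (t : 'I_w -> nat) (pi'' : 'I_w -> algC) :
    prime_element_choice zeta N1 (A zeta) p pi ->
    prime_element_choice zeta N2 (A (zeta ^+ 3)) q pi' ->
    prime_element_choice zeta N3 (A (zeta ^+ 2)) t pi'' ->
  let alpha := u_ zeta (\prod_i pi i) * \prod_i pi i
               * (u_ zeta (\prod_i pi' i) * \prod_i pi' i)
               * (u_ zeta (\prod_i pi'' i) * \prod_i pi'' i) in
  1 - zeta %| alpha - 1 /\ exists theta, [/\ theta \in Z,
      forall z, z \in Z -> z ^+ 5 %| theta -> z %| 1
    & alpha ^+ 5 *
      - (A zeta * A (zeta ^+ 3) ^+ 2 * A (zeta ^+ 2) ^+ 3 * A (zeta ^+ 4) ^+ 4) =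
      M%:R ^+ 5 * theta].
Proof.
have [N1_D N2_D N3_D _] := Delta_nat_numerators.
move=> /(normalized_choice_spec zeta_prim n_not5 zeta_prim N1_D)[Z1 r1 d1 v1].
move=> /(normalized_choice_spec zeta_prim n_not5 (prim5_exp (k := 3) zeta_prim isT) N2_D).
move=> [Z2 r2 d2 v2].
move=> /(normalized_choice_spec zeta_prim n_not5 (prim5_exp (k := 2) zeta_prim isT) N3_D).
move=> [Z3 r3 d3 v3]; split; last exact: theta_exists.
by do 2?[apply: residue1M => //].
Qed.

End Theta.

(** * The orbit of a root of Lehmer's quintic *)

Lemma lehmer_quinticE n : lehmer_quintic n =
  Poly [:: 1; n ^+ 3 + 4 * n ^+ 2 + 10 * n + 10;
    n ^+ 4 + 5 * n ^+ 3 + 11 * n ^+ 2 + 15 * n + 5;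
    - (2 * n ^+ 3 + 6 * n ^+ 2 + 10 * n + 10); n ^+ 2; 1].
Proof. by rewrite /= !cons_poly_def /lehmer_quintic; ring. Qed.

Lemma size_lehmer_quintic n : size (lehmer_quintic n) = 6.
Proof. by rewrite lehmer_quinticE (@PolyK _ 1). Qed.

Lemma lehmer_quintic_monic n : lehmer_quintic n \is monic.
Proof. by rewrite lehmer_quinticE monicE lead_coefE (@PolyK _ 1). Qed.

Definition lehmer_equation (R : nzRingType) (N x : R) : Prop :=
  x ^+ 5 = - N ^+ 2 * x ^+ 4
  + (2 * N ^+ 3 + 6 * N ^+ 2 + 10 * N + 10) * x ^+ 3
  - (N ^+ 4 + 5 * N ^+ 3 + 11 * N ^+ 2 + 15 * N + 5) * x ^+ 2
  - (N ^+ 3 + 4 * N ^+ 2 + 10 * N + 10) * x - 1.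

Lemma root_lehmer_quinticP (F : fieldType) n (x : F) :
  root (map_poly intr (lehmer_quintic n)) x -> lehmer_equation n%:~R x.
Proof.
rewrite lehmer_quinticE rootE map_Poly horner_Poly /= => /eqP x_root.
by rewrite /lehmer_equation -[LHS]subr0 -[X in _ - X]x_root; ring.
Qed.

Lemma lehmer_den_neq0 (n : int) : n ^+ 3 + 5 * n ^+ 2 + 10 * n + 7 != 0.
Proof.
have -> : n ^+ 3 + 5 * n ^+ 2 + 10 * n + 7 = (n + 1) * ((n + 2) ^+ 2 + 2) + 1 by ring.
by have := sqr_ge0 (n + 2); case: (leP 0 (n + 1)) => ? ?; apply/eqP; nia.
Qed.

Definition lehmer_orbit (R : comNzRingType) (N : R) (r : nat -> R) : Prop :=
  [/\ forall i, r (i + 5)%N = r i,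
      r 0%N + r 1%N + r 2%N + r 3%N + r 4%N = - N ^+ 2,
      forall i, r i.+1 * (1 + (N + 2) * r i) = N + 2 + N * r i - r i ^+ 2,
      forall i,
        r i * r i.+1 = - (1 + N + N ^+ 2) + N * r i - r i.+1 - r (i + 3)%N
    & forall i, r i * r i.+2 = - (1 + N) + r i.+1 + (N + 2) * r i.+2].

Lemma lehmer_orbit_map (R S : comNzRingType) (f : {rmorphism R -> S}) N r :
  lehmer_orbit N r -> lehmer_orbit (f N) (f \o r).
Proof.
move=> [r5 r_sum r_step r_mul1 r_mul2]; split=> [i||i|i|i] /=.
- by rewrite r5.
- by rewrite -!rmorphD r_sum; ring.
- transitivity (f (r i.+1 * (1 + (N + 2) * r i))); first by ring.
  by rewrite r_step; ring.
- by rewrite -rmorphM r_mul1; ring.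
by rewrite -rmorphM r_mul2; ring.
Qed.

Section Orbit.

Variables (K : fieldType) (s : {rmorphism K -> K}) (N x : K).
Hypothesis sN : s N = N.
Hypothesis x_root : lehmer_equation N x.
Hypothesis sx : s x = (N + 2 + N * x - x ^+ 2) / (1 + (N + 2) * x).

Let den : K := N ^+ 3 + 5 * N ^+ 2 + 10 * N + 7.
Hypothesis den0 : den != 0.

(* [num_j / den] is [s^j x], reduced to a polynomial of degree at most 4 in [x]. *)
Let num1 : K :=
   (22 + 39 * N + 26 * N ^+ 2 + 8 * N ^+ 3 + N ^+ 4)
   + (36 + 107 * N + 131 * N ^+ 2 + 89 * N ^+ 3 + 37 * N ^+ 4 + 9 * N ^+ 5 + N ^+ 6) * x
   + (- 39 - 80 * N - 76 * N ^+ 2 - 43 * N ^+ 3 - 14 * N ^+ 4 - 2 * N ^+ 5) * x ^+ 2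
   + (- 2 - N + 4 * N ^+ 2 + 4 * N ^+ 3 + N ^+ 4) * x ^+ 3
   + (4 + 4 * N + N ^+ 2) * x ^+ 4.
Let num2 : K :=
   (- 6 - 7 * N - 2 * N ^+ 2)
   + (- 6 - 29 * N - 36 * N ^+ 2 - 21 * N ^+ 3 - 7 * N ^+ 4 - N ^+ 5) * x
   + (24 + 41 * N + 31 * N ^+ 2 + 14 * N ^+ 3 + 3 * N ^+ 4) * x ^+ 2
   + (- 2 - 3 * N - 4 * N ^+ 2 - 2 * N ^+ 3) * x ^+ 3
   + (- 3 - 2 * N) * x ^+ 4.
Let num3 : K :=
   (- 25 - 52 * N - 47 * N ^+ 2 - 24 * N ^+ 3 - 7 * N ^+ 4 - N ^+ 5)
   + (- 18 - 59 * N - 81 * N ^+ 2 - 62 * N ^+ 3 - 29 * N ^+ 4 - 8 * N ^+ 5 - N ^+ 6) * x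
   + (23 + 53 * N + 54 * N ^+ 2 + 33 * N ^+ 3 + 12 * N ^+ 4 + 2 * N ^+ 5) * x ^+ 2
   + (1 + N - 2 * N ^+ 2 - 3 * N ^+ 3 - N ^+ 4) * x ^+ 3
   + (- 2 - 3 * N - N ^+ 2) * x ^+ 4.
Let num4 : K :=
   (9 + 20 * N + 16 * N ^+ 2 + 6 * N ^+ 3 + N ^+ 4)
   + (- 19 - 29 * N - 19 * N ^+ 2 - 7 * N ^+ 3 - N ^+ 4) * x
   + (- 8 - 14 * N - 9 * N ^+ 2 - 4 * N ^+ 3 - N ^+ 4) * x ^+ 2
   + (3 + 3 * N + 2 * N ^+ 2 + N ^+ 3) * x ^+ 3
   + (1 + N) * x ^+ 4.

(* A vanishing denominator would give s x = 0, by the convention on division. *)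
Lemma orbit_denominator_neq0 j : 1 + (N + 2) * iter j s x != 0.
Proof.
elim: j => [|j IH] /=.
  apply/eqP => d0; move: sx; rewrite d0 invr0 mulr0 => /eqP; rewrite fmorph_eq0.
  move=> /eqP x0; move: x_root; rewrite x0 => /eqP.
  rewrite -subr_eq0 (_ : _ - _ = 1); last by ring.
  by rewrite oner_eq0.
have -> : 1 + (N + 2) * s (iter j s x) = s (1 + (N + 2) * iter j s x).
  by rewrite rmorphD rmorphM rmorphD rmorph1 rmorph_nat sN.
by rewrite fmorph_eq0.
Qed.

Lemma orbit_step j : iter j.+1 s x * (1 + (N + 2) * iter j s x) =
  N + 2 + N * iter j s x - iter j s x ^+ 2.
Proof.
elim: j => [|j IH] /=; first by rewrite sx divfK //; have := orbit_denominator_neq0 0.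
transitivity (s (iter j.+1 s x * (1 + (N + 2) * iter j s x))).
  by rewrite /=; ring: sN.
by rewrite IH; ring: sN.
Qed.

Lemma orbit_next j (p q : K) : iter j s x = p / den ->
    q * (den + (N + 2) * p) = (N + 2) * den ^+ 2 + N * p * den - p ^+ 2 ->
  iter j.+1 s x = q / den.
Proof.
move=> jE pq; apply: (mulIf (orbit_denominator_neq0 j)); rewrite orbit_step jE.
apply: (mulIf den0); apply: (mulIf den0).
have -> : q / den * (1 + (N + 2) * (p / den)) * den * den =
    q * (den + (N + 2) * p) by field.
by rewrite pq; field.
Qed.

Let orbit0 : iter 0 s x = x * den / den. Proof. by rewrite mulfK. Qed.

Let orbit1 : iter 1 s x = num1 / den.
Proof. by apply: (orbit_next orbit0); rewrite /num1 /den; ring: x_root. Qed.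

Let orbit2 : iter 2 s x = num2 / den.
Proof. by apply: (orbit_next orbit1); rewrite /num1 /num2 /den; ring: x_root. Qed.

Let orbit3 : iter 3 s x = num3 / den.
Proof. by apply: (orbit_next orbit2); rewrite /num2 /num3 /den; ring: x_root. Qed.

Let orbit4 : iter 4 s x = num4 / den.
Proof. by apply: (orbit_next orbit3); rewrite /num3 /num4 /den; ring: x_root. Qed.

Lemma orbit5 : iter 5 s x = x.
Proof.
rewrite -[RHS](mulfK den0).
by apply: (orbit_next orbit4); rewrite /num4 /den; ring: x_root.
Qed.

Lemma orbit_sum : x + iter 1 s x + iter 2 s x + iter 3 s x + iter 4 s x = - N ^+ 2.
Proof.
rewrite orbit1 orbit2 orbit3 orbit4; apply: (mulIf den0).
have -> : (x + num1 / den + num2 / den + num3 / den + num4 / den) * den =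
    x * den + num1 + num2 + num3 + num4 by field.
by rewrite /num1 /num2 /num3 /num4 /den; ring.
Qed.

Lemma orbit_mul1 :
  x * iter 1 s x = - (1 + N + N ^+ 2) + N * x - iter 1 s x - iter 3 s x.
Proof.
rewrite orbit1 orbit3; apply: (mulIf den0).
have -> : x * (num1 / den) * den = x * num1 by field.
have -> : (- (1 + N + N ^+ 2) + N * x - num1 / den - num3 / den) * den =
   (- (1 + N + N ^+ 2) + N * x) * den - num1 - num3 by field.
by rewrite /num1 /num3 /den; ring: x_root.
Qed.

Lemma orbit_mul2 :
  x * iter 2 s x = - (1 + N) + iter 1 s x + (N + 2) * iter 2 s x.
Proof.
rewrite orbit1 orbit2; apply: (mulIf den0).
have -> : x * (num2 / den) * den = x * num2 by field.
have -> : (- (1 + N) + num1 / den + (N + 2) * (num2 / den)) * den =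
   - (1 + N) * den + num1 + (N + 2) * num2 by field.
by rewrite /num1 /num2 /den; ring: x_root.
Qed.

Lemma orbit_mul1_iter i : iter i s x * iter i.+1 s x =
  - (1 + N + N ^+ 2) + N * iter i s x - iter i.+1 s x - iter (i + 3) s x.
Proof.
elim: i => [|i IH]; first exact: orbit_mul1.
transitivity (s (iter i s x * iter i.+1 s x)); first by rewrite rmorphM.
by rewrite IH /=; ring: sN.
Qed.

Lemma orbit_mul2_iter i : iter i s x * iter i.+2 s x =
  - (1 + N) + iter i.+1 s x + (N + 2) * iter i.+2 s x.
Proof.
elim: i => [|i IH]; first exact: orbit_mul2.
transitivity (s (iter i s x * iter i.+2 s x)); first by rewrite rmorphM.
by rewrite IH /=; ring: sN.
Qed.

Lemma iter_lehmer_orbit : lehmer_orbit N (fun i => iter i s x).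
Proof.
split=> [i|||i|i].
- by rewrite iterD orbit5.
- exact: orbit_sum.
- exact: orbit_step.
- exact: orbit_mul1_iter.
exact: orbit_mul2_iter.
Qed.

End Orbit.

(** * Lagrange resolvents *)

Section IterMorphism.

Variables (R : nzRingType) (s : {rmorphism R -> R}).

Fact iter_zmod_morphism j : zmod_morphism (iter j s).
Proof. by elim: j => // j IH x y; rewrite !iterS IH rmorphB. Qed.
HB.instance Definition _ j :=
  GRing.isZmodMorphism.Build R R (iter j s) (iter_zmod_morphism j).

Fact iter_monoid_morphism j : monoid_morphism (iter j s).
Proof.
elim: j => [|j [IH1 IHM]]; first by split.
by split=> [|x y]; rewrite !iterS ?IH1 ?IHM ?rmorph1 ?rmorphM.
Qed.
HB.instance Definition _ j :=
  GRing.isMonoidMorphism.Build R R (iter j s) (iter_monoid_morphism j).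

End IterMorphism.

Definition lagrange (R : nzRingType) (m : nat) (r : nat -> R) (z : R) : R :=
  \sum_(j < m) r j * z ^+ j.

Section Resolvent.

Variables (L : nzRingType) (E : fieldType) (m : nat).
Variables (s : {rmorphism L -> L}) (emb : {rmorphism L -> E}).

Definition resolvent (w : E) (y : L) : E :=
  lagrange m (fun j => emb (iter j s y)) w^-1.

Fact resolvent_zmod_morphism w : zmod_morphism (resolvent w).
Proof.
move=> x y; rewrite /resolvent /lagrange -sumrB; apply: eq_bigr => j _.
by rewrite !rmorphB mulrBl.
Qed.
HB.instance Definition _ w :=
  GRing.isZmodMorphism.Build L E (resolvent w) (resolvent_zmod_morphism w).

Lemma resolventZ w c y : s c = c -> resolvent w (c * y) = emb c * resolvent w y.
Proof.
move=> sc; rewrite /resolvent /lagrange mulr_sumr; apply: eq_bigr => j _.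
by rewrite rmorphM /= (iter_fix j sc) rmorphM mulrA.
Qed.

Lemma resolvent1 y : resolvent 1 y = emb (\sum_(j < m) iter j s y).
Proof.
rewrite /resolvent /lagrange rmorph_sum; apply: eq_bigr => j _.
by rewrite invr1 expr1n mulr1.
Qed.

Lemma resolvent1_fixed c : s c = c -> resolvent 1 c = m%:R * emb c.
Proof.
move=> sc; rewrite resolvent1; under eq_bigr => j _ do rewrite (iter_fix j sc).
by rewrite sumr_const card_ord rmorphMn mulr_natl.
Qed.

Lemma resolvent_fixed w c : w ^+ m = 1 -> w != 1 -> s c = c -> resolvent w c = 0.
Proof.
move=> wm w1 sc; rewrite /resolvent /lagrange.
under eq_bigr => j _ do rewrite (iter_fix j sc).
have wV1 : w^-1 - 1 != 0 by rewrite subr_eq0 invr_eq1.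
rewrite -mulr_sumr; apply/eqP; rewrite mulf_eq0; apply/orP; right.
by rewrite -(mulrI_eq0 _ (mulfI wV1)) -subrX1 exprVn wm invr1 subrr.
Qed.

Hypothesis s_order : forall y, iter m s y = y.

Lemma resolvent_step w y : w ^+ m = 1 -> resolvent w (s y) = w * resolvent w y.
Proof.
rewrite /resolvent /lagrange; case: m s_order => [|k] s_k wk.
  by rewrite !big_ord0 mulr0.
have w0 : w != 0 by apply: contra_eq_neq wk => ->; rewrite expr0n eq_sym oner_neq0.
rewrite big_ord_recr big_ord_recl /= expr0 mulr1 mulrDr addrC -iterSr s_k.
have wVk : w^-1 ^+ k = w.
  by apply: (mulfI (expf_neq0 k w0)); rewrite exprVn divff ?expf_neq0 // -exprSr wk.
rewrite wVk mulrC; congr (_ + _).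
rewrite mulr_sumr; apply: eq_bigr => j _.
by rewrite -iterSr /bump add1n exprS mulrCA mulVKf.
Qed.

Lemma resolvent_iter w y j : w ^+ m = 1 ->
  resolvent w (iter j s y) = w ^+ j * resolvent w y.
Proof.
move=> wm; elim: j => [|j IH]; first by rewrite mul1r.
by rewrite iterS resolvent_step // IH mulrA exprS.
Qed.

Lemma resolvent_comb k w (c : nat -> L) y : w ^+ m = 1 -> (forall j, s (c j) = c j) ->
  resolvent w (\sum_(j < k) c j * iter j s y) =
    (\sum_(j < k) emb (c j) * w ^+ j) * resolvent w y.
Proof.
move=> wm sc; rewrite raddf_sum mulr_suml; apply: eq_bigr => j _ /=.
by rewrite resolventZ // resolvent_iter // mulrA.
Qed.

Lemma resolvent_inversion zeta y : (0 < m)%N -> m.-primitive_root zeta ->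
  m%:R * emb y = \sum_(k < m) resolvent (zeta ^+ k) y.
Proof.
move=> m0 zeta_prim; have zeta0 : zeta != 0 by rewrite (prim_root_eq0 zeta_prim) -lt0n.
have sum_pow j : (0 < j < m)%N -> \sum_(k < m) (zeta ^+ k)^-1 ^+ j = 0.
  move=> /andP[j0 jm]; have zj1 : zeta^-1 ^+ j - 1 != 0.
    rewrite subr_eq0 exprVn invr_eq1 -(prim_order_dvd zeta_prim).
    by rewrite gtnNdvd.
  apply: (mulfI zj1); rewrite mulr0.
  under eq_bigr => k _ do rewrite -exprVn exprAC.
  by rewrite -subrX1 exprVn exprVn exprAC (prim_expr_order zeta_prim) expr1n invr1 subrr.
rewrite /resolvent /lagrange exchange_big (bigD1 (Ordinal m0)) //= [X in _ + X]big1 => [|j j0].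
  under eq_bigr => k _ do rewrite expr0 mulr1.
  by rewrite sumr_const card_ord addr0 mulr_natl.
by rewrite -mulr_sumr sum_pow ?mulr0 // ltn_ord andbT lt0n.
Qed.

End Resolvent.

Section LehmerResolvent.

Variables (R : comNzRingType) (N w : R) (r : nat -> R).
Hypothesis r_orbit : lehmer_orbit N r.
Hypothesis w4 : w ^+ 4 = - 1 - w - w ^+ 2 - w ^+ 3.

Local Notation tau := (lagrange 5 r).
Local Notation A z := (N + 2 + 2 * z ^+ 4 + z ^+ 2).

Lemma lehmer_orbit_sqr i : r i ^+ 2 = 4 + 4 * N + 3 * N ^+ 2 + N ^+ 3
  - (N + N ^+ 2) * r i + (1 + N) * r i.+1 + (N + 2) * r (i + 3)%N.
Proof.
have [_ _ r_step r_mul1 _] := r_orbit.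
transitivity (N + 2 + N * r i - r i.+1 - (N + 2) * (r i * r i.+1)).
  apply/eqP; rewrite -subr_eq0; apply/eqP.
  transitivity (r i.+1 * (1 + (N + 2) * r i) - (N + 2 + N * r i - r i ^+ 2)).
    by ring.
  by rewrite r_step subrr.
by rewrite r_mul1; ring.
Qed.

(* The analogues of |tau|^2 = p and of the Jacobi sum tau(chi)^2 / tau(chi^2)
   for Gauss sums. *)
Lemma lehmer_gauss_jacobi :
  tau w * tau (w ^+ 4) = N ^+ 4 + 5 * N ^+ 3 + 15 * N ^+ 2 + 25 * N + 25
  /\ tau (w ^+ 4) ^+ 2 = - A (w ^+ 2) * A (w ^+ 4) * tau (w ^+ 3).
Proof.
have [r5 r_sum _ r_mul1 r_mul2] := r_orbit.
have r4E : r 4%N = - N ^+ 2 - r 0%N - r 1%N - r 2%N - r 3%N by rewrite -r_sum; ring.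
have m01 := r_mul1 0%N; have m12 := r_mul1 1%N; have m23 := r_mul1 2%N.
have m02 := r_mul2 0%N; have m13 := r_mul2 1%N.
have m30 : r 0%N * r 3%N = - (1 + N) + r 4%N + (N + 2) * r 0%N.
  by rewrite mulrC -(r5 0%N) (r_mul2 3%N).
have s0 := lehmer_orbit_sqr 0; have s1 := lehmer_orbit_sqr 1.
have s2 := lehmer_orbit_sqr 2; have s3 := lehmer_orbit_sqr 3.
rewrite /= ?(r5 0%N) ?(r5 1%N) !r4E in m01 m12 m23 m02 m13 m30 s0 s1 s2 s3.
rewrite /lagrange !big_ord_recl !big_ord0 /= /bump /= !r4E.
move: m01 m12 m23 m02 m13 m30 s0 s1 s2 s3.
rewrite ![(_ + 3)%N]/= ?(r5 0%N) ?(r5 1%N).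
move: (r 0%N) (r 1%N) (r 2%N) (r 3%N) => r0 r1 r2 r3.
move=> m01 m12 m23 m02 m13 m30 s0 s1 s2 s3.
by split; ring: m01 m12 m23 m02 m13 m30 s0 s1 s2 s3 w4.
Qed.

End LehmerResolvent.

Lemma lehmer_gauss_norm n (w : algC) r : 5.-primitive_root w -> lehmer_orbit n%:~R r ->
  lagrange 5 r w * lagrange 5 r (w ^+ 4) = (lehmer_Delta n)%:~R.
Proof.
move=> w_prim r_orbit.
by have [-> _] := lehmer_gauss_jacobi r_orbit (prim5_exp4 w_prim); rewrite /lehmer_Delta; ring.
Qed.

Lemma lehmer_jacobi n (w : algC) r : 5.-primitive_root w -> lehmer_orbit n%:~R r ->
  lagrange 5 r (w ^+ 4) ^+ 2 =
  - A_ (w ^+ 2) n * A_ (w ^+ 4) n * lagrange 5 r (w ^+ 3).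
Proof.
move=> w_prim r_orbit.
by have [_ ->] := lehmer_gauss_jacobi r_orbit (prim5_exp4 w_prim).
Qed.

Lemma lehmer_lagrange_pow5 n (w : algC) r : 5.-primitive_root w -> lehmer_orbit n%:~R r ->
  lagrange 5 r w^-1 ^+ 5 =
  - (A_ w n * A_ (w ^+ 3) n ^+ 2 * A_ (w ^+ 2) n ^+ 3 * A_ (w ^+ 4) n ^+ 4).
Proof.
move=> w_prim r_orbit; have w5 := prim_expr_order w_prim.
have wV : w^-1 = w ^+ 4.
  have w0 : w != 0 by rewrite (prim_root_eq0 w_prim).
  by apply: (mulfI w0); rewrite divff // -exprS w5.
have norm := lehmer_gauss_norm w_prim r_orbit; have jacobi1 := lehmer_jacobi w_prim r_orbit.
have := lehmer_jacobi (prim5_exp (k := 2) w_prim isT) r_orbit.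
rewrite -!exprM -(expr_mod 8 w5) -(expr_mod 6 w5) expr1 => jacobi2.
rewrite wV (_ : 5 = 1 + 2 * 2)%N // exprD exprM jacobi1.
transitivity (lagrange 5 r (w ^+ 4) * (A_ (w ^+ 2) n * A_ (w ^+ 4) n) ^+ 2 *
  lagrange 5 r (w ^+ 3) ^+ 2); first by ring.
rewrite jacobi2.
transitivity (- (A_ (w ^+ 2) n ^+ 2 * A_ (w ^+ 4) n ^+ 3 * A_ (w ^+ 3) n) *
  (lagrange 5 r w * lagrange 5 r (w ^+ 4))); first by ring.
by rewrite norm -(prod_A n w_prim); ring.
Qed.

(** * Number fields in the algebraic numbers *)

Lemma rmorphism_factor (A L E : nzRingType) (ev : {rmorphism A -> L})
    (h : {rmorphism A -> E}) :
    (forall y, exists a, ev a = y) -> (forall a, ev a = 0 -> h a = 0) ->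
  exists f : {rmorphism L -> E}, forall a, f (ev a) = h a.
Proof.
move=> /choice[lift liftK] ker_h; pose f y := h (lift y).
have fE a : f (ev a) = h a.
  apply/eqP; rewrite -subr_eq0 -rmorphB; apply/eqP/ker_h.
  by rewrite rmorphB liftK subrr.
have f_zmod : zmod_morphism f.
  by move=> y z; rewrite -(liftK y) -(liftK z) -rmorphB !fE rmorphB.
have f_monoid : monoid_morphism f.
  split=> [|y z]; first by rewrite -(rmorph1 ev) fE rmorph1.
  by rewrite -(liftK y) -(liftK z) -rmorphM !fE rmorphM.
pose fB := GRing.isZmodMorphism.Build _ _ f f_zmod.
pose fM := GRing.isMonoidMorphism.Build _ _ f f_monoid.
by exists (HB.pack_for {rmorphism L -> E} f fB fM).
Qed.

Section PrimitiveElement.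

Variables (F : fieldType) (L : fieldExtType F) (x : L).

Lemma dim_Fadjoin_lt_size (p : {poly F}) : p != 0 ->
  root (map_poly (in_alg L) p) x -> (\dim <<1; x>> < size p)%N.
Proof.
move=> p0 px; rewrite dim_Fadjoin dimv1 muln1 -size_minPoly.
rewrite -(size_map_poly (in_alg L)) dvdp_leq ?map_poly_eq0 //.
by rewrite minPoly_dvdp ?alg_polyOver.
Qed.

Hypothesis L_gen : <<1; x>>%VS = {:L}%VS.

Lemma horner_alg_surj y : exists p : {poly F}, horner_alg x p = y.
Proof.
have : y \in <<1; x>>%VS by rewrite L_gen memvf.
by move=> /Fadjoin_polyP[q /polyOver1P[p ->] ->]; exists p.
Qed.

Lemma rmorphism_extends (E : closedFieldType) (phi : {rmorphism F -> E}) :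
  exists f : {rmorphism L -> E}, forall a, f a%:A = phi a.
Proof.
have /polyOver1P[m mE] := minPolyOver 1 x.
have [r mr] : exists r, root (map_poly phi m) r.
  apply/closed_rootP; rewrite size_map_poly -(size_map_poly (in_alg L)) -mE.
  by rewrite size_minPoly gtn_eqF // ltnS.
pose h : {rmorphism {poly F} -> E} := horner_morph (fun a => mulrC r (phi a)).
have [p px0|f fE] := rmorphism_factor (h := h) horner_alg_surj.
  have : (minPoly 1 x %| map_poly (in_alg L) p)%R.
    by rewrite minPoly_dvdp ?alg_polyOver // rootE; apply/eqP.
  rewrite mE dvdp_map => /dvdpP[t ->].
  by rewrite rmorphM (rootP mr : h m = 0) mulr0.
by exists f => a; have := fE a%:P; rewrite /= horner_algC horner_morphC.
Qed.

End PrimitiveElement.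

Lemma rmorphism_gen_id (L : fieldExtType rat) (x : L) (f : {rmorphism L -> L}) :
  <<1; x>>%VS = {:L}%VS -> f x = x -> f =1 id.
Proof.
move=> L_gen fx y; have [p <-] := horner_alg_surj L_gen y.
rewrite /horner_alg /horner_morph -horner_map fx -map_poly_comp; congr _.[_].
by apply: eq_map_poly => a /=; rewrite alg_num_field fmorph_rat.
Qed.

Lemma Aint_root m (x : algC) : (0 < m)%N -> x ^+ m \in Aint -> x \in Aint.
Proof.
move=> m0 Ax; apply: (@root_monic_Aint (minCpoly (x ^+ m) \Po 'X^m)).
- by rewrite rootE horner_comp hornerXn -rootE root_minCpoly.
- rewrite monicE lead_coef_comp ?size_polyXn // lead_coefXn expr1n mulr1.
  by rewrite -monicE minCpoly_monic.
by rewrite polyOver_comp ?rpredX ?polyOverX.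
Qed.

Lemma root_map_intr (K L : fieldType) (f : {rmorphism K -> L}) (p : {poly int}) y :
  root (map_poly intr p) (f y) = root (map_poly intr p) y.
Proof. by rewrite !rootE -horner_map_intr fmorph_eq0. Qed.

Lemma Aint_emb (L : fieldExtType rat) (emb : {rmorphism L -> algC}) y :
  emb y \in Aint <-> ring_of_integers y.
Proof.
split=> [/floorpP[p pE]|[p p_monic py]].
  exists p.
    have := minCpoly_monic (emb y); rewrite pE !monicE.
    by rewrite (lead_coef_map_inj (@intr_inj algC) (erefl _)) (eqr_int algC _ 1).
  by rewrite -(root_map_intr emb) -pE root_minCpoly.
apply: (@root_monic_Aint (map_poly intr p)); last 2 first.
- exact: monic_map.
- by apply/polyOverP => i; rewrite coef_map /= intr_int.
by rewrite root_map_intr.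
Qed.

Lemma ring_of_integers_rmorph (L : fieldExtType rat) (s : {rmorphism L -> L}) y :
  ring_of_integers y -> ring_of_integers (s y).
Proof.
by move=> [p p_monic py]; exists p; rewrite ?root_map_intr.
Qed.

Lemma ring_of_integers_iter (L : fieldExtType rat) (s : {rmorphism L -> L}) y j :
  ring_of_integers y -> ring_of_integers (iter j s y).
Proof. by move=> y_int; elim: j => //= j; apply: ring_of_integers_rmorph. Qed.

Lemma common_denominator k (q : nat -> rat) :
  exists2 D : int, D != 0 & forall j, (j < k)%N -> D%:~R * q j \in Num.int.
Proof.
elim: k => [|k [D D0 Dq]]; first by exists 1.
exists (D * denq (q k)) => [|j]; first by rewrite mulf_neq0 ?denq_neq0.
rewrite rmorphM ltnS leq_eqVlt => /predU1P[->|/Dq Dqj].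
  by rewrite -mulrA [_ * q k]mulrC -numqE rpredM ?rpred_int.
by rewrite mulrAC rpredM ?rpred_int.
Qed.

(** * A criterion for normal integral bases *)

Section NormalIntegralBasis.

Variables (zeta : algC) (L : fieldExtType rat).
Variables (s : {rmorphism L -> L}) (emb : {rmorphism L -> algC}) (alpha : L).
Hypothesis zeta_prim : 5.-primitive_root zeta.
Hypothesis s_order : forall y, iter 5 s y = y.
Hypothesis dim_L : (\dim {:L} <= 5)%N.

Local Notation tau := (resolvent 5 s emb).
Local Notation Z := (Zint zeta).
Local Notation comb q := (\sum_(j < 5) ratr (q j) * iter j s alpha).

Hypothesis alpha_int : ring_of_integers alpha.
Hypothesis trace_alpha : (tau 1 alpha = 1) \/ (tau 1 alpha = -1).
Hypothesis theta_mem : tau zeta alpha ^+ 5 \in Z.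
Hypothesis theta_free : forall z, z \in Z ->
  tau zeta alpha ^+ 5 \in sdvd Z (z ^+ 5) -> 1 \in sdvd Z z.

Let z5 : zeta ^+ 5 = 1 := prim_expr_order zeta_prim.

Let trace_neq0 : tau 1 alpha != 0.
Proof. by case: trace_alpha => ->; rewrite ?oppr_eq0 oner_eq0. Qed.

Let tau_neq0 : tau zeta alpha != 0.
Proof.
apply/eqP => tau0; have := theta_free (rpred0 _).
rewrite tau0 expr0n /= rpred0 => /(_ isT)/sdvdP[q _ /eqP].
by rewrite mul0r oner_eq0.
Qed.

Let tau_Aint y : ring_of_integers y -> tau zeta y \in Aint.
Proof.
move=> y_int; rewrite rpred_sum // => j _; rewrite rpredM ?rpredX //.
  exact/Aint_emb/ring_of_integers_iter.
by apply: (Aint_unity_root (n := 5)) => //; apply/unity_rootP; rewrite exprVn z5 invr1.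
Qed.

Lemma resolvent_rat_comb (q : nat -> rat) w : w ^+ 5 = 1 ->
  tau w (comb q) = (\sum_(j < 5) ratr (q j) * w ^+ j) * tau w alpha.
Proof.
move=> w5; have s_rat j : s (ratr (q j)) = ratr (q j) by apply: fmorph_rat.
rewrite (resolvent_comb emb s_order _ _ w5 s_rat); congr (_ * _).
by apply: eq_bigr => j _; rewrite fmorph_rat.
Qed.

Lemma conjugates_rat_free (q : nat -> rat) : comb q = 0 ->
  forall j, (j < 5)%N -> q j = 0.
Proof.
move=> comb0; have := resolvent_rat_comb q z5; rewrite comb0 raddf0 => /esym/eqP.
rewrite mulf_eq0 (negPf tau_neq0) orbF => /eqP.
move=> /(prim_root_relation (isT : prime 5) zeta_prim) q_const.
have := resolvent_rat_comb q (expr1n _ 5); rewrite comb0 raddf0 => /esym/eqP.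
rewrite mulf_eq0 (negPf trace_neq0) orbF.
under eq_bigr => j _ do rewrite expr1n mulr1 (q_const j (ltn_ord j)).
rewrite sumr_const card_ord mulrn_eq0 /= fmorph_eq0 => /eqP q4 j j5.
by rewrite q_const.
Qed.

Lemma conjugates_rat_span x : exists q : nat -> rat, x = comb q.
Proof.
pose X := [tuple iter j s alpha | j < 5].
have ratrZ a y : a *: y = ratr a * y :> L by rewrite -alg_num_field mulr_algl.
have X_free : free X.
  apply/freeP => k Xk0 j; rewrite -[j]inord_val.
  apply: (conjugates_rat_free (q := fun i => k (inord i))) => //.
  rewrite -[RHS]Xk0; apply: eq_bigr => i _.
  by rewrite ratrZ inord_val -tnth_nth tnth_mktuple.
have X_basis : basis_of {:L} X.
  by rewrite basisEfree X_free subvf size_tuple.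
exists (fun j => coord X (inord j) x).
rewrite {1}(coord_basis X_basis (memvf x)); apply: eq_bigr => j _.
by rewrite ratrZ inord_val -tnth_nth tnth_mktuple.
Qed.

(* [c = sum_j c_j zeta^j] satisfies [c^5 tau(alpha)^5 = tau(x)^5], so that it is
   in Z[zeta] and all the [c_j] differ from [c_4] by integers.  Subtracting them
   leaves [c_4 Tr(alpha)], an algebraic integer. *)
Lemma integral_coords_int (q : nat -> rat) : ring_of_integers (comb q) ->
  forall j, (j < 5)%N -> q j \in Num.int.
Proof.
move=> comb_int; pose c := \sum_(j < 5) ratr (q j) * zeta ^+ j.
have tauE : tau zeta (comb q) = c * tau zeta alpha := resolvent_rat_comb q z5.
have [D D0 Dq] := common_denominator 5 q.
have DC0 : D%:~R != 0 :> algC by rewrite intr_eq0.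
have ZDc : D%:~R * c \in Z.
  rewrite mulr_sumr rpred_sum // => j _; rewrite mulrA rpredM ?rpredX ?Zint_gen //.
  rewrite -(ratr_int algC) -rmorphM /=.
  by have /intrP[k ->] := Dq j (ltn_ord j); rewrite ratr_int rpred_int.
have [N euclid] := Zint_euclidean zeta_prim.
have Zc : c \in Z.
  apply: (euclidean_power_free euclid theta_mem theta_free (rpred_int _ D) DC0 ZDc).
  apply: (Aint_Zint zeta_prim (rpredX 5 (rpred_int _ D)) (expf_neq0 5 DC0)).
    by rewrite mulrA -exprMn rpredM // rpredX.
  by rewrite -exprMn -tauE rpredX // tau_Aint.
have q_sub j : (j < 5)%N -> q j - q 4%N \in Num.int :=
  Zint_rat_coords zeta_prim Zc (j := j).
suff q4 : q 4%N \in Num.int by move=> j /q_sub qj; rewrite -(subrK (q 4%N) (q j)) rpredD.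
have : ratr (q 4%N) * tau 1 alpha \in Aint.
  have -> : ratr (q 4%N) * tau 1 alpha =
      emb (comb q) - \sum_(j < 5) ratr (q j - q 4%N) * emb (iter j s alpha).
    rewrite resolvent1 !rmorph_sum -sumrB mulr_sumr; apply: eq_bigr => j _.
    by rewrite rmorphM fmorph_rat rmorphB /=; ring.
  apply: rpredB; first exact/Aint_emb.
  rewrite rpred_sum // => j _.
  have /intrP[k ->] := q_sub j (ltn_ord j); rewrite ratr_int rpredM ?Aint_int //.
  exact/Aint_emb/ring_of_integers_iter.
have c4_rat : ratr (q 4%N) \in Crat := Crat_rat _.
rewrite -Cint_rat; case: trace_alpha => ->; rewrite ?mulr1 ?mulrN1 ?rpredN;
  exact: Cint_rat_Aint.
Qed.

Lemma normal_integral_basis_criterion :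
  is_Z_basis (@ring_of_integers L) (fun j : 'I_5 => iter j s alpha).
Proof.
have combE (q : nat -> rat) (c : 'I_5 -> int) : (forall j : 'I_5, q j = (c j)%:~R) ->
    \sum_(j < 5) iter j s alpha *~ c j = comb q.
  by move=> qc; apply: eq_bigr => j _; rewrite qc ratr_int mulrzl.
split=> [j|x x_int|c comb0 j]; first exact: ring_of_integers_iter.
  have [q xE] := conjugates_rat_span x; rewrite xE in x_int.
  exists (fun j => Num.floor (q j)); rewrite xE; apply/esym/combE => j.
  by rewrite floorK ?(integral_coords_int x_int).
pose q i : rat := (c (inord i))%:~R.
have qE (i : 'I_5) : q i = (c i)%:~R by rewrite /q inord_val.
apply: (@intr_inj rat); rewrite -qE (conjugates_rat_free (q := q)) //.
by rewrite -(combE q c).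
Qed.

End NormalIntegralBasis.

(** * The generator *)

Lemma legendre5_cases n : ~~ (5 %| n)%Z -> legendre n 5 = 1 \/ legendre n 5 = -1.
Proof. by rewrite /legendre => /negPf ->; case: ifP; [left | right]. Qed.

Lemma legendre5_mod5 n : ~~ (5 %| n)%Z -> (5 %| legendre n 5 - n ^+ 2)%Z.
Proof.
move=> n5; have squareE : [exists y : 'I_5, (Posz y ^+ 2 == n %[mod 5])%Z] =
    ((n %% 5)%Z \in [:: 0; 1; 4]).
  apply/existsP/idP => [[[[|[|[|[|[|]]]]] // ?] /eqP <-] //|].
  by rewrite !inE => /or3P[]/eqP ->; [exists 0 | exists 1 | exists 2].
have r_cases : [|| (n %% 5)%Z == 1, (n %% 5)%Z == 2, (n %% 5)%Z == 3 | (n %% 5)%Z == 4].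
  by lia.
have nE := divz_eq n 5; rewrite /legendre (negPf n5) squareE {squareE n5}.
case/or4P: r_cases nE => /eqP -> ->; rewrite ?inE /=; apply/dvdzP; set q := (n %/ 5)%Z.
- by exists (- (5 * q ^+ 2 + 2 * q)); ring.
- by exists (- (5 * q ^+ 2 + 4 * q + 1)); ring.
- by exists (- (5 * q ^+ 2 + 6 * q + 2)); ring.
by exists (- (5 * q ^+ 2 + 8 * q + 3)); ring.
Qed.

Section Generator.

Variables (zeta : algC) (n : int) (L : fieldExtType rat).
Variables (s : {rmorphism L -> L}) (emb : {rmorphism L -> algC}) (rho : L).
Hypothesis zeta_prim : 5.-primitive_root zeta.
Hypothesis s_order : forall y, iter 5 s y = y.
Hypothesis dim_L : (\dim {:L} <= 5)%N.
Hypothesis rho_int : ring_of_integers rho.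
Hypothesis rho_orbit : lehmer_orbit n%:~R (fun i => iter i s rho).

Local Notation tau := (resolvent 5 s emb).
Local Notation Z := (Zint zeta).
Local Notation A w := (A_ w n).

Variables (b : nat -> int) (M : nat) (m eps : int) (theta : algC) (alpha : L).

Local Notation beta w := (\sum_(j < 4) (b j)%:~R * w ^+ j).

Hypothesis M_mod5 : (M %% 5 = 1)%N.
Hypothesis eps_cases : eps = 1 \/ eps = -1.
Hypothesis m_eq : 5 * m = eps * M%:Z - n ^+ 2 * \sum_(j < 4) b j.
Hypothesis alpha_eq :
  M%:R * alpha = \sum_(j < 4) (b j)%:~R * iter j s rho - m%:~R.
Hypothesis theta_mem : theta \in Z.
Hypothesis theta_free : forall z, z \in Z -> theta \in sdvd Z (z ^+ 5) -> 1 \in sdvd Z z.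
Hypothesis theta_eq : beta zeta ^+ 5 *
  - (A zeta * A (zeta ^+ 3) ^+ 2 * A (zeta ^+ 2) ^+ 3 * A (zeta ^+ 4) ^+ 4) =
  M%:R ^+ 5 * theta.

Let M_neq0 : M%:R != 0 :> algC.
Proof. by rewrite pnatr_eq0; apply: contra_eq_neq M_mod5 => ->. Qed.

Let emb_orbit : lehmer_orbit n%:~R (fun i => emb (iter i s rho)).
Proof. by have := lehmer_orbit_map emb rho_orbit; rewrite rmorph_int. Qed.

Let resolvent_numerator w : w ^+ 5 = 1 ->
  M%:R * tau w alpha = beta w * tau w rho - tau w m%:~R.
Proof.
move=> w5; have s_int j : s (b j)%:~R = (b j)%:~R by rewrite rmorph_int.
rewrite -(rmorph_nat emb) -resolventZ ?rmorph_nat // alpha_eq raddfB /=.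
rewrite (resolvent_comb emb s_order _ _ w5 s_int); congr (_ * _ - _).
by apply: eq_bigr => j _; rewrite rmorph_int.
Qed.

Lemma trace_generator : tau 1 alpha = - eps%:~R.
Proof.
apply: (mulfI M_neq0); rewrite resolvent_numerator ?expr1n //.
have -> : tau 1 rho = - n%:~R ^+ 2.
  have [_ <- _ _ _] := emb_orbit.
  by rewrite resolvent1 rmorph_sum !big_ord_recr big_ord0 /= add0r.
rewrite resolvent1_fixed ?rmorph_int //.
under eq_bigr => j _ do rewrite expr1n mulr1.
have mE : 5 * m%:~R = eps%:~R * M%:R - n%:~R ^+ 2 * \sum_(j < 4) (b j)%:~R :> algC.
  by rewrite -rmorph_sum; transitivity ((5 * m)%:~R : algC); [ring | rewrite m_eq; ring].
by rewrite mE; ring.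
Qed.

Lemma resolvent_generator_pow5 (nu : {rmorphism algC -> algC}) :
  tau (nu zeta) alpha ^+ 5 = nu theta.
Proof.
set w := nu zeta; have w_prim : 5.-primitive_root w by rewrite fmorph_primitive_root.
have w5 := prim_expr_order w_prim.
have w1 : w != 1 by rewrite -[w]expr1 -(prim_order_dvd w_prim).
apply: (mulfI (expf_neq0 5 M_neq0)); rewrite -exprMn resolvent_numerator //.
rewrite (resolvent_fixed emb w5 w1 (rmorph_int s m)) subr0 exprMn.
rewrite (lehmer_lagrange_pow5 w_prim emb_orbit).
transitivity (nu (M%:R ^+ 5 * theta)); last by rewrite rmorphM rmorphXn rmorph_nat.
have A_nu k : nu (A (zeta ^+ k)) = A (w ^+ k) by rewrite A_aut rmorphXn.
have <- : nu (beta zeta) = beta w.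
  rewrite rmorph_sum; apply: eq_bigr => j _.
  by rewrite rmorphM rmorph_int rmorphXn.
by rewrite -theta_eq -!A_nu -A_aut; ring.
Qed.

Lemma generator_int : ring_of_integers alpha.
Proof.
apply/(Aint_emb emb); have alpha5 : 5%:~R * emb alpha \in Aint.
  rewrite (resolvent_inversion s emb _ (m := 5) _ zeta_prim) // big_ord_recl.
  rewrite expr0 trace_generator rpredD ?rpredN ?Aint_int // rpred_sum // => k _.
  have [nu <-] := prim5_aut zeta_prim (prim5_exp (k := k.+1) zeta_prim (ltn_ord k)).
  apply: (@Aint_root 5) => //; rewrite resolvent_generator_pow5 Aint_aut.
  exact: (Zint_Aint (Aint_prim_root zeta_prim)).
have alphaM : M%:~R * emb alpha \in Aint.
  rewrite -(rmorph_int emb) -rmorphM; apply/Aint_emb.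
  rewrite alpha_eq; apply/(Aint_emb emb); rewrite rmorphB rmorph_int rmorph_sum.
  rewrite rpredB ?Aint_int // rpred_sum // => j _; rewrite rmorphM rmorph_int.
  by rewrite rpredM ?Aint_int //; apply/Aint_emb/ring_of_integers_iter.
have /coprimezP[[u v] /= uv] : coprimez M 5.
  by rewrite coprimezE coprime_sym prime_coprime // /dvdn M_mod5.
rewrite -[emb alpha]mul1r -[1]/(1%:~R) -uv rmorphD !rmorphM mulrDl -!mulrA.
by apply: rpredD; apply: rpredM; rewrite ?Aint_int.
Qed.

Lemma generator_basis :
  is_Z_basis (@ring_of_integers L) (fun j : 'I_5 => iter j s alpha).
Proof.
have tau_pow5 : tau zeta alpha ^+ 5 = theta := resolvent_generator_pow5 idfun.
apply: (normal_integral_basis_criterion (emb := emb) zeta_prim s_order dim_L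
  generator_int); rewrite ?tau_pow5 //.
by rewrite trace_generator; case: eps_cases => ->; [right | left; rewrite opprK].
Qed.

End Generator.

Lemma generator_constant_dvd5 zeta n M x (b0 b1 b2 b3 : int) :
    5.-primitive_root zeta -> ~~ (5 %| n)%Z -> (M %% 5 = 1)%N ->
    x - 1 \in sdvd (Zint zeta) (1 - zeta) ->
    x = cubic_at zeta b0%:~R b1%:~R b2%:~R b3%:~R ->
  (5 %| legendre n 5 * M%:Z - n ^+ 2 * (b0 + b1 + b2 + b3))%Z.
Proof.
move=> zeta_prim n_not5 M_mod5 x1 xE.
have /dvdzP[u uE] : (5 %| b0 + b1 + b2 + b3 - 1)%Z.
  rewrite -(one_sub_zeta_dvd_int zeta_prim) rmorphB -(subrKA x) rpredD //.
  by rewrite xE -opprB rpredN cubic_at_residue.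
have /dvdzP[v vE] := legendre5_mod5 n_not5.
have ME := divn_eq M 5; rewrite M_mod5 in ME.
apply/dvdzP; exists (v * M%:Z + n ^+ 2 * (M %/ 5)%N%:Z - n ^+ 2 * u).
rewrite -[_ + b3](subrK 1) uE -[legendre n 5](subrK (n ^+ 2)) vE.
by rewrite [in LHS]ME PoszD PoszM; move: (M %/ 5)%N ME => q ->; ring.
Qed.

Section LehmerField.

Variables (n : int) (L : fieldExtType rat) (rho : L) (s : {rmorphism L -> L}).
Hypothesis rho_root : root (map_poly intr (lehmer_quintic n)) rho.
Hypothesis L_gen : <<1; rho>>%VS = {:L}%VS.
Hypothesis s_rho :
  s rho = (n%:~R + 2 + n%:~R * rho - rho ^+ 2) / (1 + (n%:~R + 2) * rho).

Let s_int : s n%:~R = n%:~R. Proof. by rewrite rmorph_int. Qed.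

Let denominator_neq0 : n%:~R ^+ 3 + 5 * n%:~R ^+ 2 + 10 * n%:~R + 7 != 0 :> L.
Proof.
have [emb _] := rmorphism_extends L_gen (ratr : {rmorphism rat -> algC}).
rewrite -(fmorph_eq0 emb); have := lehmer_den_neq0 n.
rewrite -(intr_eq0 algC); congr (_ != 0); by ring.
Qed.

Lemma lehmer_root_int : ring_of_integers rho.
Proof. by exists (lehmer_quintic n); first exact: lehmer_quintic_monic. Qed.

Lemma lehmer_field_dim : (\dim {:L} <= 5)%N.
Proof.
pose q : {poly rat} := map_poly intr (lehmer_quintic n).
have q_size : size q = 6.
  by rewrite size_map_inj_poly ?size_lehmer_quintic //; apply: intr_inj.
have q_rho : root (map_poly (in_alg L) q) rho.
  rewrite -map_poly_comp (eq_map_poly (g := intr)) // => t /=.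
  by rewrite alg_num_field ratr_int.
have := dim_Fadjoin_lt_size _ q_rho; rewrite q_size L_gen ltnS; apply.
by rewrite -size_poly_eq0 q_size.
Qed.

Lemma lehmer_sigma_orbit : lehmer_orbit n%:~R (fun i => iter i s rho).
Proof. exact: iter_lehmer_orbit s_int (root_lehmer_quinticP rho_root) s_rho denominator_neq0. Qed.

Lemma lehmer_sigma_order y : iter 5 s y = y.
Proof.
have s5_rho := orbit5 s_int (root_lehmer_quinticP rho_root) s_rho denominator_neq0.
exact: (rmorphism_gen_id (f := iter 5 s) L_gen s5_rho).
Qed.

End LehmerField.

Lemma gal_iter (F : fieldType) (L : splittingFieldType F) (sigma : gal_of {:L}) i y :
  (sigma ^+ i)%g y = iter i sigma y.
Proof.
elim: i => [|i IH]; first by rewrite expg0 gal_id.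
by rewrite expgSr galM ?memvf // IH.
Qed.

Lemma normal_integral_basis_iter (L : splittingFieldType rat) (sigma : gal_of {:L}) y :
  is_Z_basis (@ring_of_integers L) (fun j : 'I_5 => iter j sigma y) ->
  normal_integral_basis_generator sigma y.
Proof.
by congr (is_Z_basis _ _); apply/funext => j; rewrite gal_iter.
Qed.

Lemma lehmer_generator_basis n (L : splittingFieldType rat) (rho : L)
    (sigma : gal_of {:L}) zeta (b0 b1 b2 b3 : int) M m (theta : algC) :
    root (map_poly intr (lehmer_quintic n)) rho -> <<1; rho>>%VS = {:L}%VS ->
    sigma rho = (n%:~R + 2 + n%:~R * rho - rho ^+ 2) / (1 + (n%:~R + 2) * rho) ->
    5.-primitive_root zeta -> ~~ (5 %| n)%Z -> (M %% 5 = 1)%N ->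
    5 * m = legendre n 5 * M%:Z - n ^+ 2 * (b0 + b1 + b2 + b3) ->
    theta \in Zint zeta ->
    (forall z, z \in Zint zeta -> theta \in sdvd (Zint zeta) (z ^+ 5) ->
      1 \in sdvd (Zint zeta) z) ->
    cubic_at zeta b0%:~R b1%:~R b2%:~R b3%:~R ^+ 5 *
      - (A_ zeta n * A_ (zeta ^+ 3) n ^+ 2 * A_ (zeta ^+ 2) n ^+ 3 *
         A_ (zeta ^+ 4) n ^+ 4) = M%:R ^+ 5 * theta ->
  normal_integral_basis_generator sigma
    (M%:R^-1 * (b0%:~R * rho + b1%:~R * sigma rho + b2%:~R * (sigma ^+ 2)%g rho
                + b3%:~R * (sigma ^+ 3)%g rho - m%:~R)).
Proof.
move=> rho_root L_gen sigma_rho zeta_prim n_not5 M_mod5 mE Ztheta theta_free thetaE.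
have [emb _] := rmorphism_extends L_gen (ratr : {rmorphism rat -> algC}).
pose b j : int := [:: b0; b1; b2; b3]`_j.
have sum_b (R : comNzRingType) (r : nat -> R) : \sum_(j < 4) (b j)%:~R * r j =
    b0%:~R * r 0%N + b1%:~R * r 1%N + b2%:~R * r 2%N + b3%:~R * r 3%N.
  by rewrite !big_ord_recr big_ord0 /= add0r.
have M0 : M%:R != 0 :> L.
  by rewrite -(fmorph_eq0 emb) rmorph_nat pnatr_eq0; apply: contra_eq_neq M_mod5 => ->.
apply: normal_integral_basis_iter.
apply: (generator_basis (s := sigma) (rho := rho) (b := b) (m := m) emb zeta_prim
  (lehmer_sigma_order rho_root L_gen sigma_rho) (lehmer_field_dim rho_root L_gen)
  (lehmer_root_int rho_root) (lehmer_sigma_orbit rho_root L_gen sigma_rho) M_mod5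
  (legendre5_cases n_not5) _ _ Ztheta theta_free).
- by rewrite mE !big_ord_recr big_ord0 /= add0r.
- by rewrite mulVKf // (sum_b L (fun j => iter j sigma rho)) !gal_iter.
by rewrite -thetaE (sum_b _ (fun j => zeta ^+ j)) expr0 expr1 mulr1.
Qed.

Theorem theorem3p9 (n : int) (L : splittingFieldType rat) (rho : L)
    (sigma : gal_of {:L}) (a b c d e : nat) (zeta : algC)
    (n_not5 : ~~ (5 %| n)%Z)
    (rho_root : root (map_poly intr (lehmer_quintic n)) rho)
    (L_gen : <<1; rho>>%VS = {:L}%VS)
    (sigma_gen : generator 'Gal({:L} / 1) sigma)
    (sigma_rho : sigma rho =
       (n%:~R + 2 + n%:~R * rho - rho ^+ 2) / (1 + (n%:~R + 2) * rho))
    (Delta_eq : lehmer_Delta n =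
       (a * b ^ 2 * c ^ 3 * d ^ 4 * e ^ 5)%N%:Z)
    (abcde_gt0 : [&& 0 < a, 0 < b, 0 < c, 0 < d & 0 < e]%N)
    (abcd_sqfree :
       [/\ squarefree a, squarefree b, squarefree c & squarefree d])
    (abcd_coprime : pairwise coprime [:: a; b; c; d])
    (zeta_prim : 5.-primitive_root zeta) :
  let N1 := (b * c ^ 2 * d ^ 3 * e ^ 3)%N in
  let N2 := (b * c * d ^ 2 * e ^ 2)%N in
  let N3 := (c * d * e)%N in
  [/\ forall p : nat, prime p -> (p %| N1)%N ->
        exists pi : algC, common_prime_divisor zeta p (A_ zeta n) pi,
      forall p : nat, prime p -> (p %| N2)%N ->
        exists pi : algC, common_prime_divisor zeta p (B_ zeta n) pi,
      forall p : nat, prime p -> (p %| N3)%N ->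
        exists pi : algC, common_prime_divisor zeta p (C_ zeta n) pi
    & forall (k : nat) (p : 'I_k -> nat) (pi : 'I_k -> algC)
             (r : nat) (q : 'I_r -> nat) (pi' : 'I_r -> algC)
             (w : nat) (s : 'I_w -> nat) (pi'' : 'I_w -> algC)
             (beta0 beta1 beta2 beta3 : int),
        prime_element_choice zeta N1 (A_ zeta n) p pi ->
        prime_element_choice zeta N2 (B_ zeta n) q pi' ->
        prime_element_choice zeta N3 (C_ zeta n) s pi'' ->
        let lambda1 := \prod_(i < k) pi i in
        let lambda2 := \prod_(j < r) pi' j in
        let lambda3 := \prod_(j < w) pi'' j in
        let alpha1 := u_ zeta lambda1 * lambda1 in
        let alpha2 := u_ zeta lambda2 * lambda2 in
        let alpha3 := u_ zeta lambda3 * lambda3 in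
        alpha1 * alpha2 * alpha3 =
          beta0%:~R + beta1%:~R * zeta + beta2%:~R * zeta ^+ 2
            + beta3%:~R * zeta ^+ 3 ->
        let M := (b * c ^ 2 * d ^ 3 * e ^ 4)%N in
        let m : rat :=
          5^-1 * (legendre n 5 * M%:Z
                  - n ^+ 2 * (beta0 + beta1 + beta2 + beta3))%:~R in
        m \is a Num.int /\
        normal_integral_basis_generator sigma
          (M%:R^-1 *
            (beta0%:~R * rho + beta1%:~R * sigma rho
             + beta2%:~R * (sigma ^+ 2)%g rho
             + beta3%:~R * (sigma ^+ 3)%g rho - ratr m))].
Proof.
have [N1_Delta N2_Delta N3_Delta M_Delta] := Delta_nat_numerators Delta_eq.
rewrite (prim5_B_A n zeta_prim) (prim5_C_A n zeta_prim) => N1 N2 N3.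
have zeta_exp_prim := prim5_exp zeta_prim.
split; do ?by move=> p; apply: exists_prime_above_pnat => //; apply: zeta_exp_prim.
move=> k p pi r q pi' w s pi'' beta0 beta1 beta2 beta3 choice1 choice2 choice3.
have [] := normalized_choices_spec zeta_prim n_not5 Delta_eq abcde_gt0 abcd_sqfree
  abcd_coprime choice1 choice2 choice3.
move=> alpha_1 [theta [Ztheta theta_free thetaE]] /= alphaE.
have M_mod5 := lehmer_pnat_mod5 n_not5 M_Delta.
have /dvdzP[m mE] := generator_constant_dvd5 zeta_prim n_not5 M_mod5 alpha_1 alphaE.
rewrite alphaE in thetaE.
rewrite mE rmorphM mulrC mulfK //; split; first exact: intr_int.
rewrite ratr_int; apply: lehmer_generator_basis thetaE => //.
by rewrite mE mulrC.
Qed.
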